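(* Let $n\ge 1$ and, for each $1\le i\le n$, let $\psi_i:\mathbb{R}_{>0}\to\mathbb{R}_{>0}$ be a non-increasing function satisfying $\psi_i(x)=o(x^{-2})$ as $x\to\infty$. Then $$\dim_{\mathcal H}\big(E(\psi_1)\times\cdots\times E(\psi_n)\big)=\min_{1\le i\le n}\big\{n-1+\dim_{\mathcal H}E(\psi_i)\big\}=\min_{1\le i\le n}\left\{n-1+\frac{2}{\lambda_i}\right\},$$ where $\lambda_i=\liminf_{x\to\infty}\frac{-\log\psi_i(x)}{\log x}$.
   Context: $\dim_{\mathcal H}$ denotes Hausdorff dimension (in $\mathbb{R}^n$ for the product set, in $\mathbb{R}$ for each $E(\psi_i)$). For $\psi:\mathbb{R}_{>0}\to\mathbb{R}_{>0}$, the set $E(\psi)$ is $$E(\psi)=\bigcap_{0<\epsilon<1}\left\{x\in[0,1]: (1-\epsilon)\psi(q)<\left|x-\frac pq\right|<\psi(q)\ \text{for infinitely many } (p,q)\in\mathbb{Z}\times\mathbb{N}\right\},$$ where $\mathbb{N}$ is the set of positive integers. If $\lambda_i=+\infty$, then $2/\lambda_i$ is read as $0$. *)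

(* Defs.v *)
From HB Require Import structures.
From mathcomp Require Import all_boot all_order all_algebra.
From mathcomp Require Import all_classical all_reals all_analysis.

Set Implicit Arguments.
Unset Strict Implicit.
Unset Printing Implicit Defensive.

Import Order.TTheory GRing.Theory Num.Theory.
Import numFieldNormedType.Exports.

Local Open Scope classical_set_scope.
Local Open Scope ring_scope.

(* Lets the library's f =o_F g be used with F the neighborhoods of +oo. *)
Canonical pinfty_nbhs_filter_on (R : realType) :=
  FilterType (pinfty_nbhs R) (@proper_pinfty_nbhs R).

Section Hausdorff.
Context {R : realType} {T : Type}.
Variable dist : T -> T -> R.

(* The added 0 only matters for the empty set, whose diameter is thus 0. *)
Definition diam (A : set T) : \bar R :=
  ereal_sup (0%E |` [set (dist xy.1 xy.2)%:E | xy in A `*` A]).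

(* Since 0 `^ 0 = 1, the empty set is singled out so that it contributes 0
   also for s = 0 (and a nonempty set contributes 1). *)
Definition diam_pow (s : R) (A : set T) : \bar R :=
  if A == set0 then 0%E else (diam A `^ s)%E.

Definition hausdorff_delta (s delta : R) (A : set T) : \bar R :=
  ereal_inf [set (\sum_(0 <= k <oo) diam_pow s (U k))%E | U in
    [set U : (set T)^nat | A `<=` \bigcup_k U k /\
                           forall k, (diam (U k) <= delta%:E)%E]].

Definition hausdorff_measure (s : R) (A : set T) : \bar R :=
  ereal_sup [set hausdorff_delta s delta A | delta in [set d : R | 0 < d]].

Definition hausdorff_dim (A : set T) : \bar R :=
  ereal_inf [set s%:E | s in [set s : R | 0 <= s /\
                                          hausdorff_measure s A = 0%E]].

End Hausdorff.

Definition real_dist {R : realType} (x y : R) : R := `|x - y|.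

(* The library's norm on row vectors is the sup norm. *)
Definition euclidean_dist {R : realType} {n : nat} (x y : 'rV[R]_n) : R :=
  Num.sqrt (\sum_(i < n) (x 0 i - y 0 i) ^+ 2).

(* Pairs (p, q) are not required to be coprime. *)
Definition exact_set {R : realType} (psi : R -> R) : set R :=
  \bigcap_(eps in `]0, 1[%classic)
    [set x : R | 0 <= x <= 1 /\
      infinite_set [set pq : int * nat | (0 < pq.2)%N /\
        (1 - eps) * psi pq.2%:R < `|x - pq.1%:~R / pq.2%:R| < psi pq.2%:R]].

Definition box {R : realType} {n : nat} (A : 'I_n -> set R) : set 'rV[R]_n :=
  [set x | forall i, A i (x 0 i)].

Definition lower_order {R : realType} (psi : R -> R) : \bar R :=
  limf_einf (fun x : R => (- ln (psi x) / ln x)%:E) (pinfty_nbhs R).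

(* Main.v *)
Require Import Defs.
From HB Require Import structures.
From mathcomp Require cyclic.
From mathcomp Require Import all_boot all_order all_algebra.
From mathcomp Require Import all_classical all_reals all_analysis measurable_realfun.
From mathcomp Require Import ring lra zify.
Import Order.TTheory GRing.Theory Num.Theory.
Import numFieldNormedType.Exports.
Set Implicit Arguments.
Unset Strict Implicit.
Unset Printing Implicit Defensive.
Local Open Scope classical_set_scope.
Local Open Scope ring_scope.

(* Upper bound: E(psi_i) is contained in the limsup set of the intervals of
   radius psi_i(q) around p/q; grouping the denominators in dyadic blocks and
   cutting the remaining n-1 coordinates into cubes of the same size makes the
   covering sums geometric.

   Lower bound: inside an interval of length about 1/b, the points (a + p/q)/b
   with p/q a fraction of denominator in (S, 4S] are at least S^2 many, pairwise
   1/(16 b S^2) apart, and next to each of them lies an interval of the annulus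
   defining E(psi_i).  Iterating gives a homogeneous Cantor subset of E(psi_i),
   parametrised by a map h_i defined on [0, 1) through mixed-radix expansions.
   A cover of the product Cantor set pulls back under (h_1, ..., h_n) to a cover
   of the unit cube by boxes, whose volumes sum to at least 1, so it suffices to
   bound the modulus of continuity of the inverse of each h_i.  This modulus is almost
   r^1, except just below a scale 1/S^2, where it is r^s with s < 2/lambda_i.
   The coordinates are refined in turn, at extremely sparse scales, so that at
   each scale at most one of the n moduli is bad. *)


(** * Fractions with large denominators *)

(** Summing Gauss's identity (the totients of the divisors of k add up to k) over k <= T counts each
    d once for every multiple of it up to T. *)
Lemma sum_totient_divn T :
  (\sum_(1 <= d < T.+1) totient d * (T %/ d) = \sum_(1 <= k < T.+1) k)%N.
Proof.
elim: T => [|T IH]; first by rewrite !big_geq.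
rewrite [RHS]big_nat_recr //= -IH big_nat_recr //= divnn /= muln1.
under eq_big_nat => d /andP[d0 _] do rewrite divnS // mulnDr.
rewrite big_split /= addnAC addnC; congr (_ + _)%N.
rewrite -[RHS]cyclic.sum_totient_dvd.
rewrite -(big_mkord (fun d => (d %| T.+1)%N) totient) [RHS]big_mkcond /=.
rewrite [RHS]big_ltn // dvd0n add0n [RHS]big_nat_recr //= dvdnn; congr (_ + _)%N.
by apply: eq_bigr => d _; case: (d %| _)%N; rewrite ?muln1 ?muln0.
Qed.

(** At T = 4S the previous identity totals 8S^2 + 2S. The d <= S account for at most 4S^2 of it, and
    each d > S is counted at most 3 times. *)
Lemma sum_totient_lb S : (S * S <= \sum_(S.+1 <= d < (4 * S).+1) totient d)%N.
Proof.
have := sum_totient_divn (4 * S).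
rewrite (@big_cat_nat _ _ _ S.+1) //=; last by lia.
have -> : (\sum_(1 <= k < (4 * S).+1) k = 2 * S * (4 * S).+1)%N.
  have := bin2_sum (4 * S).+1.
  rewrite big_ltn // add0n => ->; rewrite bin2 /=.
  by rewrite (_ : (_ * _ = (2 * S * (4 * S).+1).*2)%N) ?doubleK //; lia.
have h1 : (\sum_(1 <= d < S.+1) totient d * (4 * S %/ d) <= S * (4 * S))%N.
  rewrite -[X in (_ <= X * _)%N](subn1 S.+1) -sum_nat_const_nat.
  rewrite big_nat [leqRHS]big_nat; apply: leq_sum => d /andP[d0 _].
  have : (totient d <= d)%N.
    by rewrite totient_count_coprime -[leqRHS]subn0 -[leqRHS]muln1
       -sum_nat_const_nat; apply: leq_sum => i _; case: coprime.
  move=> /leq_mul -/(_ _ _ (leqnn (4 * S %/ d))) /leq_trans; apply.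
  by rewrite mulnC leq_trunc_div.
have h2 : (\sum_(S.+1 <= d < (4 * S).+1) totient d * (4 * S %/ d) <=
   3 * \sum_(S.+1 <= d < (4 * S).+1) totient d)%N.
  rewrite big_distrr big_nat [leqRHS]big_nat.
  apply: leq_sum => d /andP[d0 _].
  rewrite [leqRHS]mulnC leq_mul2l -ltnS ltn_divLR ?(leq_ltn_trans _ d0) //.
  by apply/orP; right; lia.
move: h1 h2; set X := bigop _ _ _; set Y := bigop _ _ _; set Z := bigop _ _ _.
nia.
Qed.

(** The reduced fractions in [0, 1) with denominator in (S, 4S] are sorted by value and the first
    S^2 kept. Being reduced, they are distinct as rationals and recovered by [numq] and [denq]. *)
Lemma farey_fractions S : exists f : nat -> nat * nat,
  (forall d, (d < S * S)%N ->
     (S < (f d).2 <= 4 * S)%N /\ ((f d).1 < (f d).2)%N) /\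
  (forall d d', (d < d')%N -> (d' < S * S)%N ->
     ((f d).1 * (f d').2 < (f d').1 * (f d).2)%N).
Proof.
pose s := [seq (p, q) | q <- index_iota S.+1 (4 * S).+1,
                        p <- [seq p <- iota 0 q | coprime q p]].
pose val (x : nat * nat) : rat := x.1%:Q / x.2%:Q.
have sP x : x \in s -> [/\ (S < x.2)%N, (x.2 <= 4 * S)%N, (x.1 < x.2)%N & coprime x.1 x.2].
  move=> /allpairsPdep[q [p [+ + ->]]] /=.
  rewrite mem_index_iota mem_filter mem_iota add0n leq0n coprime_sym ltnS /=.
  by move=> /andP[-> ->] /andP[-> ->].
have cop x : x \in s -> coprime `|x.1%:Z| `|x.2%:Z| by move=> /sP[].
have numv x : x \in s -> numq (val x) = x.1.
  by move=> xs; rewrite /val coprimeq_num ?cop // gtr0_sg ?mul1r //;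
    case/sP: xs => A _ _ _; rewrite ltz_nat (leq_ltn_trans _ A).
have denv x : x \in s -> denq (val x) = x.2.
  move=> xs; rewrite /val coprimeq_den ?cop // eqz_nat; case/sP: xs => A _ _ _.
  by rewrite ifF //; apply/negbTE; rewrite -lt0n (leq_ltn_trans _ A).
have us : uniq s.
  apply: allpairs_uniq_dep => [|q _|[q p] [q' p'] _ _ /= [-> ->] //].
    exact: iota_uniq.
  by rewrite filter_uniq // iota_uniq.
have uv : uniq (map val s).
  rewrite map_inj_in_uniq // => x y xs ys e.
  have := numv _ xs; rewrite e numv // => -[e1].
  have := denv _ xs; rewrite e denv // => -[e2].
  by case: x y e1 e2 {xs ys e} => [? ?] [? ?] /= -> ->.
have szs : (S * S <= size s)%N.
  apply: (leq_trans (sum_totient_lb S)); rewrite size_allpairs_dep.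
  rewrite sumnE big_map; apply: leq_sum => q _.
  rewrite size_filter totient_count_coprime -sum1_count [leqRHS]big_mkcond /=.
  by rewrite /index_iota subn0; apply: leq_sum => i _; case: coprime.
pose t : seq rat := sort <=%O (map val s).
have tE (y : rat) : y \in t -> exists2 x, x \in s & y = val x.
  by rewrite mem_sort => /mapP[x xs ->]; exists x.
have st : sorted <%O t by rewrite sort_lt_sorted.
have szt : size t = size s by rewrite size_sort size_map.
exists (fun d => (`|numq t`_d|%N, `|denq t`_d|%N)); split=> [d dS|d d' dd dS] /=.
  have [|x xs ->] := tE t`_d; first by rewrite mem_nth // szt (leq_trans dS).
  by rewrite numv // denv //; case/sP: xs => /= -> -> ->.
have d't : (d' < size t)%N by rewrite szt (leq_trans dS).
have dt : (d < size t)%N by rewrite (ltn_trans dd).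
have : t`_d < t`_d'.
  by apply: (sorted_ltn_nth lt_trans) => //; rewrite inE.
have [x xs ->] := tE _ (mem_nth 0 dt); have [y ys ->] := tE _ (mem_nth 0 d't).
rewrite !numv // !denv // /val; case/sP: xs => + _ _ _; case/sP: ys => + _ _ _.
move=> y0 x0; rewrite ltr_pdivrMr ?ltr0z ?ltz_nat ?(leq_ltn_trans _ x0) //.
rewrite mulrAC ltr_pdivlMr ?ltr0z ?ltz_nat ?(leq_ltn_trans _ y0) //.
by rewrite -!intrM ltr_int -!PoszM ltz_nat.
Qed.

(** Consecutive distinct fractions differ by at least 1/(q q') >= 1/(16 S^2), and the gaps add
    up. *)
Lemma farey_spacing (R : realType) S : exists f : nat -> nat * nat,
  (forall d, (d < S * S)%N ->
     (S < (f d).2 <= 4 * S)%N /\ ((f d).1 < (f d).2)%N) /\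
  (forall d d', (d < d')%N -> (d' < S * S)%N ->
     (d' - d)%:R / (16 * S%:R ^+ 2) <=
       (f d').1%:R / (f d').2%:R - (f d).1%:R / (f d).2%:R :> R).
Proof.
have [f [fb fm]] := farey_fractions S.
exists f; split=> // d d' + d'S.
have succ e : (e.+1 < S * S)%N -> (16 * S%:R ^+ 2)^-1 <=
    (f e.+1).1%:R / (f e.+1).2%:R - (f e).1%:R / (f e).2%:R :> R.
  move=> eS; have := fm e e.+1 (ltnSn _) eS.
  have [/andP[Sq' q'S] _] := fb _ eS; have [/andP[Sq qS] _] := fb e (ltnW eS).
  move: (f e) (f e.+1) Sq qS Sq' q'S => [p q] [p' q'] /= Sq qS Sq' q'S pq.
  have q0 : (0 < q)%N by lia.
  have q'0 : (0 < q')%N by lia.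
  have -> : p'%:R / q'%:R - p%:R / q%:R = (p' * q - p * q')%N%:R / (q' * q)%N%:R :> R.
    rewrite natrB; last exact: ltnW.
    by rewrite !natrM; field; rewrite !pnatr_eq0 -!lt0n q0 q'0.
  rewrite ler_pdivlMr ?ltr0n ?muln_gt0 ?q0 ?q'0 // mulrC.
  apply: (@le_trans _ _ 1); last by rewrite ler1n subn_gt0.
  rewrite ler_pdivrMr ?mul1r.
    by rewrite -natrX -natrM ler_nat; nia.
  by rewrite mulr_gt0 // exprn_gt0 // ltr0n; lia.
elim: d' d'S => // d' IH d'S; rewrite ltnS leq_eqVlt => /orP[/eqP dE|dd].
  by rewrite dE subSnn mul1r; exact: succ.
have := lerD (IH (ltnW d'S) dd) (succ _ d'S).
rewrite subSn ?(ltnW dd) // -(natr1 (d' - d)) (mulrDl _ 1) mul1r.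
by move=> h; apply: (le_trans h); rewrite addrC subrKA.
Qed.

(** One step of the Cantor construction: [A, A + L] is the parent, the [F d] are the left ends of
    S^2 children of length [L'], each inside the annulus of one fraction, and the last inequality
    bounds the gaps between children. *)
Lemma exact_subintervals (R : realType) (psi : R -> R) (A L L' eps : R) (b S : nat) :
  (forall x, 0 < x -> 0 < psi x) ->
  (forall x y, 0 < x -> x <= y -> psi y <= psi x) ->
  (forall x, S%:R <= x -> psi x <= x ^- 2 / 64) ->
  (0 < b)%N -> (0 < S)%N -> 2 <= b%:R * L -> 0 < eps < 1 ->
  0 < L' <= eps * psi (4 * b * S)%:R / 4 ->
  exists F : nat -> R,
  (forall d, (d < S * S)%N -> [/\ A <= F d, F d + L' <= A + L &
     exists p : int, exists2 q : nat, (S <= q)%N &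
       forall x, F d <= x <= F d + L' ->
         (1 - eps) * psi q%:R < `|x - p%:~R / q%:R| < psi q%:R]) /\
  (forall d d', (d < d')%N -> (d' < S * S)%N ->
     (d' - d)%:R / (32 * b%:R * S%:R ^+ 2) <= F d' - F d - L').
Proof.
move=> psi0 psim psi2 b0 S0 bL /andP[e0 e1] /andP[L'0 L'e].
have [f [fb fm]] := farey_spacing R S.
(* Since b L >= 2, the interval [a/b, (a + 1)/b] lies in [A, A + L]. *)
pose a := Num.ceil (A * b%:R).
have aA : A * b%:R <= a%:~R by exact: ceil_ge.
have aA1 : a%:~R < A * b%:R + 1.
  by rewrite -ltrBlDr -[1 in X in X < _]mulr1z -intrB ceilB1_lt.
pose P d : R := (f d).1%:R; pose Q d : R := (f d).2%:R.
pose psiq d := psi (b%:R * Q d).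
have B1 : 1 <= b%:R :> R by rewrite ler1n.
have s1 : 1 <= S%:R :> R by rewrite ler1n.
pose X d := (a%:~R + P d / Q d) / b%:R.
have key d : (d < S * S)%N -> [/\ S%:R < Q d, P d + 1 <= Q d, 0 < psiq d,
    psiq d <= (b%:R * Q d) ^- 2 / 64 & L' <= eps * psiq d / 4].
  move=> dS; have [/andP[Sq qS] pq] := fb _ dS.
  have Q0 : 0 < b%:R * Q d by rewrite mulr_gt0 ?ltr0n // (leq_ltn_trans _ Sq).
  split; rewrite ?ltr_nat // /P /Q.
  - by rewrite natr1 ler_nat.
  - exact: psi0.
  - apply: psi2; rewrite -[leLHS]mul1r ler_pM // ler_nat; exact: ltnW.
  - apply: (le_trans L'e); rewrite ler_pM2r ?invr_gt0 // ler_pM2l //.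
    apply: psim => //; rewrite mulnAC mulnC !natrM ler_pM2l ?ltr0n //.
    by rewrite -natrM ler_nat.
(* The child lies to the right of [X d], at distances between (1 - eps/2) psi and (1 - eps/4) psi,
   strictly inside the annulus. *)
exists (fun d => X d + (1 - eps / 2) * psiq d); split.
  move=> d dS; have [SQ PQ psi_gt psi_le L'le] := key d dS.
  have Q0 : 0 < Q d by lra.
  have BQ0 : 0 < b%:R * Q d by rewrite mulr_gt0; lra.
  have epsi : 0 < eps * psiq d by rewrite mulr_gt0.
  have ab : A <= a%:~R / b%:R by rewrite ler_pdivlMr //; lra.
  split.
  - rewrite /X mulrDl; have : 0 <= P d / Q d / b%:R.
      by rewrite !mulr_ge0 ?invr_ge0 // ?ler0n //; lra.
    nra.
  - have h1 : psiq d <= (b%:R * Q d)^-1.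
      apply: (le_trans psi_le); rewrite -exprVn expr2.
      have : (b%:R * Q d)^-1 <= 1 by rewrite invf_le1 //; nra.
      have : 0 < (b%:R * Q d)^-1 by rewrite invr_gt0.
      nra.
    have h2 : X d + (b%:R * Q d)^-1 <= (a%:~R + 1) / b%:R.
      rewrite /X invfM [b%:R^-1 * _]mulrC -mulrDl ler_pM2r ?invr_gt0; last by lra.
      rewrite -addrA -[X in _ + (_ + X)]mul1r -mulrDl lerD2l ler_pdivrMr //; lra.
    have h3 : (a%:~R + 1) / b%:R <= A + L by rewrite ler_pdivrMr; nra.
    lra.
  - exists (a * (f d).2 + (f d).1)%R; exists (b * (f d).2)%N.
      by have [/andP[Sq _] _] := fb _ dS; rewrite (leq_trans (ltnW Sq)) // leq_pmull.
    move=> x /andP[x1 x2].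
    have -> : (b * (f d).2)%:R = b%:R * Q d by rewrite natrM.
    have -> : (a * (f d).2 + (f d).1)%:~R / (b%:R * Q d) = X d.
      rewrite intrD intrM /X -/(P d) -/(Q d) /P /Q -!pmulrn; field.
      by rewrite (lt0r_neq0 Q0) (lt0r_neq0 (lt_le_trans _ B1)).
    rewrite -/(psiq d).
    move: (psiq d) (X d) psi_gt epsi L'le x1 x2 => y z y0 ey L'y x1 x2.
    have ey1 : eps * y < y by rewrite -subr_gt0 -{1}[y]mul1r -mulrBl mulr_gt0 ?subr_gt0.
    rewrite ger0_norm; last by lra.
    by apply/andP; split; lra.
move=> d d' dd d'S; have := fm _ _ dd d'S.
have [SQ PQ psi_gt psi_le L'le] := key d (ltn_trans dd d'S).
have [_ _ psi_gt' _ _] := key d' d'S.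
rewrite -/(P d) -/(Q d) -/(P d') -/(Q d') => h.
have BS0 : 0 < b%:R * S%:R ^+ 2 :> R by rewrite mulr_gt0 ?exprn_gt0 //; lra.
(* The radius is at most a quarter of the spacing 1/(16 b S^2) of the centres, so that half of the
   spacing survives as a gap. *)
have h1 : psiq d <= (b%:R * S%:R ^+ 2)^-1 / 64.
  apply: (le_trans psi_le); rewrite ler_pM2r ?invr_gt0 // exprMn lef_pV2 ?posrE //.
    apply: ler_pM; rewrite ?ler_wpM2r //; rewrite ?exprn_ge0 //; try lra.
      by rewrite expr2; nra.
    by rewrite !expr2; nra.
  by rewrite mulr_gt0 ?exprn_gt0 //; lra.
have h2 : (d' - d)%:R * (b%:R * S%:R ^+ 2)^-1 / 16 <= X d' - X d.
  rewrite /X -mulrBl opprD addrACA subrr add0r.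
  rewrite ler_pdivlMr; last by lra.
  apply: le_trans h; rewrite le_eqVlt; apply/orP; left; apply/eqP.
  field; rewrite !lt0r_neq0 //; lra.
have d1 : 1 <= (d' - d)%:R :> R by rewrite ler1n subn_gt0.
have -> : (32 * b%:R * S%:R ^+ 2)^-1 = (b%:R * S%:R ^+ 2)^-1 / 32 :> R.
  by rewrite -mulrA invfM mulrC.
have BS1 : 0 < (b%:R * S%:R ^+ 2)^-1 :> R by rewrite invr_gt0.
move: BS1 h1 h2; move: (_^-1) => z z0 h1 h2.
have h3 : z <= (d' - d)%:R * z by rewrite ler_peMl // ltW.
have : eps * psiq d <= psiq d by rewrite ger_pMl // ltW.
have : 0 < eps * psiq d' by rewrite mulr_gt0.
have : eps * psiq d' <= psiq d' by rewrite ger_pMl // ltW.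
move: h1 h2 h3; rewrite [(d' - d)%:R * (z / 32)]mulrA.
move: (_ * z) psi_gt psi_gt' L'le => w *.
lra.
Qed.

(** * Covers of the unit cube *)

(** The covering inequality is integrated over [0, 1), where each interval contributes at most its
    length. The weights [b] serve the induction on the dimension below. *)
Lemma weighted_interval_cover (R : realType) (b : nat -> R) (c w : nat -> R) :
  (forall k, 0 <= b k) -> (forall k, 0 <= w k) ->
  (forall x, 0 <= x < 1 ->
     (1 <= \sum_(0 <= k <oo) (b k * \1_(`[c k - w k, c k + w k]%classic) x)%:E)%E) ->
  (1 <= \sum_(0 <= k <oo) (b k * (2 * w k))%:E)%E.
Proof.
move=> b0 w0 cov.
pose D : set R := `[0, 1[%classic.
have mD : measurable D by exact: measurable_itv.
pose mu := @lebesgue_measure R.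
pose I k : set R := `[c k - w k, c k + w k]%classic.
have mI k : measurable (I k) by exact: measurable_itv.
pose ind k x : \bar R := (\1_(I k) x)%:E.
pose g k x : \bar R := ((b k)%:E * ind k x)%E.
have mind k : measurable_fun D (ind k).
  by apply/measurable_EFinP; exact: measurable_indic.
have g0 k x : (0 <= g k x)%E by rewrite mule_ge0 // lee_fin.
have mg k : measurable_fun D (g k).
  by apply: emeasurable_funM => //; exact: measurable_cst.
have -> : 1%E = (\int[mu]_(x in D) cst 1%E x)%E.
  rewrite integral_cst // mul1e; have := lebesgue_measure_itv (`[0:R, 1[%R).
  by rewrite /= lte_fin ltr01 oppr0 adde0 => ->.
apply: (@le_trans _ _ (\int[mu]_(x in D) \sum_(0 <= k <oo) g k x)%E).
  apply: ge0_le_integral => //.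
  by apply: (@ge0_emeasurable_sum _ _ _ D g xpredT) => // k x _ _; exact: g0.

rewrite integral_nneseries //; apply: lee_nneseries; [by move=> k *; exact: integral_ge0|move=> k _].
rewrite ge0_integralZl_EFin //; [|by move=> x _; rewrite lee_fin|exact: mind].
rewrite integral_indic //; last exact: mI.
rewrite [leRHS]EFinM; apply: lee_wpmul2l; first by rewrite lee_fin.
apply: (@le_trans _ _ (mu (I k))).
  apply: le_measure; rewrite ?inE; [|exact: mI|by move=> x []].
  by apply: measurableI; [exact: mI|exact: mD].
rewrite [mu _](lebesgue_measure_itv (`[c k - w k, c k + w k]%R)) /= lte_fin; case: ifP => _.
  by rewrite lee_fin; lra.
by rewrite lee_fin mulr_ge0.
Qed.

(** Induction on the dimension: at a fixed first coordinate x the indicator at x joins the weights,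
    the induction hypothesis treats the other coordinates, and the one-dimensional case integrates x
    out. *)
Lemma weighted_box_cover (R : realType) n (a : nat -> R) (c w : nat -> 'I_n -> R) :
  (forall k, 0 <= a k) -> (forall k i, 0 <= w k i) ->
  (forall u : 'I_n -> R, (forall i, 0 <= u i < 1) ->
     (1 <= \sum_(0 <= k <oo)
       (a k * \prod_i \1_(`[c k i - w k i, c k i + w k i]%classic) (u i))%:E)%E) ->
  (1 <= \sum_(0 <= k <oo) (a k * \prod_i (2 * w k i))%:E)%E.
Proof.
elim: n a c w => [|n IH] a c w a0 w0 cov.
  have := cov (fun=> 0) => /(_ (fun i => False_ind _ (match i with Ordinal _ h => notF h end))).
  by under eq_eseriesr do rewrite big_ord0; under [in X in _ -> X]eq_eseriesr do rewrite big_ord0.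
under eq_eseriesr do rewrite big_ord_recl mulrCA mulrC.
apply: (@weighted_interval_cover _ _ (fun k => c k ord0)) => // [k|x x01].
  by rewrite mulr_ge0 // prodr_ge0 // => i _; rewrite mulr_ge0.
under eq_eseriesr do rewrite mulrAC.
apply: (IH _ (fun k i => c k (lift ord0 i)) (fun k i => w k (lift ord0 i))) => // [k|u u01].
  by rewrite mulr_ge0.
pose v i := if unlift ord0 i is Some j then u j else x.
have /cov : forall i, 0 <= v i < 1 by move=> i; rewrite /v; case: unlift.
move=> /le_trans; apply; rewrite le_eqVlt; apply/orP; left; apply/eqP.
apply: eq_eseriesr => k _; rewrite big_ord_recl /v unlift_none mulrA.
by congr (_ * _)%:E; apply: eq_bigr => i _; rewrite liftK.
Qed.

Lemma box_cover (R : realType) n (c w : nat -> 'I_n -> R) :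
  (forall k i, 0 <= w k i) ->
  (forall u : 'I_n -> R, (forall i, 0 <= u i < 1) ->
     exists k, forall i, `|u i - c k i| <= w k i) ->
  (1 <= \sum_(0 <= k <oo) (\prod_i (2 * w k i))%:E)%E.
Proof.
move=> w0 cov; have := @weighted_box_cover R n (fun=> 1) c w (fun=> ler01) w0.
under [in X in (_ -> X) -> _]eq_eseriesr do rewrite mul1r; apply => u /cov[k uk].
have t0 j : (0 <= (1 * \prod_i \1_(`[c j i - w j i, c j i + w j i]%classic) (u i))%:E :> \bar R)%E.
  by rewrite lee_fin mul1r prodr_ge0.
apply: (@le_trans _ _ (\sum_(0 <= j < k.+1)
  (1 * \prod_i \1_(`[c j i - w j i, c j i + w j i]%classic) (u i))%:E)%E).
  rewrite big_nat_recr //= -[leLHS]add0e leeD ?sume_ge0 // lee_fin mul1r.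
  rewrite big1 // => i _; rewrite indicE mem_set //= in_itv /=.
  by have := uk i; rewrite ler_norml => /andP[? ?]; apply/andP; split; lra.
by apply: nneseries_lim_ge => j _ _; exact: t0.
Qed.

(** * Hausdorff measures *)

Section HausdorffTheory.
Context {R : realType} {T : Type}.
Variable dist : T -> T -> R.
Implicit Types (A B : set T) (s t d : R).

Lemma diam_ge0 A : (0 <= diam dist A)%E.
Proof. by apply: ereal_sup_ubound; left. Qed.

Lemma dist_le_diam A x y : A x -> A y -> ((dist x y)%:E <= diam dist A)%E.
Proof. by move=> Ax Ay; apply: ereal_sup_ubound; right; exists (x, y). Qed.

Lemma diam_le A d : 0 <= d -> (forall x y, A x -> A y -> dist x y <= d) ->
  (diam dist A <= d%:E)%E.
Proof.
move=> d0 Ad; apply: ge_ereal_sup => _ [->|[[x y] /= [Ax Ay] <-]].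
  by rewrite lee_fin.
by rewrite lee_fin Ad.
Qed.

Lemma diam0 : diam dist set0 = 0%E.
Proof. by apply/eqP; rewrite eq_le diam_ge0 diam_le. Qed.

Lemma diam_pow_ge0 s A : (0 <= diam_pow dist s A)%E.
Proof. by rewrite /diam_pow; case: ifP => // _; exact: poweR_ge0. Qed.

Lemma diam_pow0 s : diam_pow dist s set0 = 0%E.
Proof. by rewrite /diam_pow eqxx. Qed.

Lemma diam_pow_le s d A : 0 <= s -> 0 <= d -> (diam dist A <= d%:E)%E ->
  (diam_pow dist s A <= (d `^ s)%:E)%E.
Proof.
move=> s0 d0 Ad; rewrite /diam_pow; case: ifP => _; first by rewrite lee_fin powR_ge0.
rewrite -poweR_EFin; apply: gt0_ler_poweR => //.
  by rewrite in_itv /= diam_ge0 leey.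
by rewrite in_itv /= lee_fin d0 leey.
Qed.

Lemma hausdorff_delta_ge0 s d A : (0 <= hausdorff_delta dist s d A)%E.
Proof.
apply: le_ereal_inf_tmp => _ [U _ <-].
by apply: nneseries_ge0 => k _ _; exact: diam_pow_ge0.
Qed.

Lemma hausdorff_measure_eq0 s A :
  (forall d e : R, 0 < d -> 0 < e -> (hausdorff_delta dist s d A <= e%:E)%E) ->
  hausdorff_measure dist s A = 0%E.
Proof.
move=> H; apply/eqP; rewrite eq_le; apply/andP; split; last first.
  apply: le_trans (ereal_sup_ubound _); first exact: (hausdorff_delta_ge0 s 1 A).
  by exists 1 => //=; rewrite ltr01.
apply: ge_ereal_sup => _ [d /= d0 <-].
by apply/lee_addgt0Pr => e e0; rewrite add0e H.
Qed.

(** The double family is enumerated along a bijection of [nat] with [nat * nat]; sums of nonnegative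
    terms do not depend on the order. *)
Lemma hausdorff_delta_cover2 s d A (U : nat -> nat -> set T) :
  (forall x, A x -> exists i j, U i j x) ->
  (forall i j, (diam dist (U i j) <= d%:E)%E) ->
  (hausdorff_delta dist s d A <=
     \sum_(0 <= i <oo) \sum_(0 <= j <oo) diam_pow dist s (U i j))%E.
Proof.
move=> cov dU; have /card_esym/ppcard_eqP[f] := card_nat2.
apply: (@le_trans _ _ (\sum_(0 <= k <oo) diam_pow dist s (U (f k).1 (f k).2))%E).
  apply: ereal_inf_lbound; exists (fun k => U (f k).1 (f k).2) => //; split => //.
  move=> x /cov[i [j Uij]]; have [k _ fk] := 'surj_f (I : [set: nat * nat] (i, j)).
  by exists k => //; rewrite fk.
rewrite nneseries_esumT; last by move=> k; exact: diam_pow_ge0.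
rewrite -(@reindex_esum _ _ _ setT setT f (fun p => diam_pow dist s (U p.1 p.2))) //.
have -> : [set: nat * nat] = [set: nat] `*`` (fun=> [set: nat]).
  by apply/seteqP; split.
rewrite -(@esum_esum _ _ _ _ _ (fun i j => diam_pow dist s (U i j))); last first.
  by move=> i j _ _; exact: diam_pow_ge0.
rewrite nneseries_esumT; last first.
  by move=> i; apply: nneseries_ge0 => j _ _; exact: diam_pow_ge0.
by apply: le_esum => i _; rewrite nneseries_esumT // => j; exact: diam_pow_ge0.
Qed.

(** Each finite family is padded with empty sets, on which [diam_pow] vanishes for every
    exponent. *)
Lemma hausdorff_delta_cover_fin s d A (I : nat -> finType)
    (U : forall i, I i -> set T) (v : nat -> R) :
  0 <= d -> (forall x, A x -> exists i j, U i j x) ->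
  (forall i j, (diam dist (U i j) <= d%:E)%E) ->
  (forall i j, (diam_pow dist s (U i j) <= (v i)%:E)%E) ->
  (hausdorff_delta dist s d A <= \sum_(0 <= i <oo) (#|I i|%:R * v i)%:E)%E.
Proof.
move=> d0 cov dU pU.
pose V i j := if insub j is Some k then U i (enum_val (k : 'I_#|I i|)) else set0.
apply: (@le_trans _ _ (\sum_(0 <= i <oo) \sum_(0 <= j <oo) diam_pow dist s (V i j))%E).
  apply: hausdorff_delta_cover2 => [x /cov[i [j Uij]]|i j].
    exists i, (enum_rank j); rewrite /V; case: insubP => /= [k _ kj|].
      by rewrite (val_inj kj : k = enum_rank j) enum_rankK.
    by rewrite ltn_ord.
  by rewrite /V; case: insub => //; rewrite diam0 lee_fin.
apply: lee_nneseries => [i _ _|i _].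
  by apply: nneseries_ge0 => j _ _; exact: diam_pow_ge0.
rewrite (@nneseries_split _ _ 0 #|I i|); last by move=> j _; exact: diam_pow_ge0.
rewrite add0n eseries0 => [|j /= ij _]; last first.
  by rewrite /V insubF ?diam_pow0 // ltnNge ij.
rewrite adde0 big_mkord.
apply: (@le_trans _ _ (\sum_(j < #|I i|) (v i)%:E)%E).
  apply: lee_sum => j _; rewrite /V; case: insubP => [k _ _ //|].
  by rewrite ltn_ord.
by rewrite sumEFin sumr_const card_ord mulr_natl.
Qed.

End HausdorffTheory.

(** * Invariance of the dimension under isometries *)

Section Isometry.
Context {R : realType} {T T' : Type}.
Variables (dist : T -> T -> R) (dist' : T' -> T' -> R) (f : T -> T') (g : T' -> T).
Hypothesis (fK : cancel f g) (gK : cancel g f).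
Hypothesis (distf : forall x y, dist' (f x) (f y) = dist x y).

Let image_set0 (A : set T) : (f @` A == set0) = (A == set0).
Proof. by apply/eqP/eqP => [/image_set0_set0|->]; rewrite ?image_set0. Qed.

Lemma diam_isometry (A : set T) : diam dist' (f @` A) = diam dist A.
Proof.
rewrite /diam; congr (ereal_sup (_ `|` _)); apply/seteqP.
split => [_ [[_ _] [[x Ax <-] [y Ay <-]] <-]|_ [[x y] [/= Ax Ay] <-]].
  by exists (x, y) => //=; rewrite distf.
by exists (f x, f y); rewrite /= ?distf //; split; exact: imageP.
Qed.

Lemma hausdorff_delta_isometry_le (s d : R) (A : set T) :
  (hausdorff_delta dist' s d (f @` A) <= hausdorff_delta dist s d A)%E.
Proof.
apply: le_ereal_inf_tmp => _ [U [AU dU] <-]; apply: ereal_inf_lbound.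
exists (fun k => f @` U k).
  split=> [_ [x /AU[k _ Uk] <-]|k]; first by exists k => //; exact: imageP.
  by rewrite diam_isometry.
by apply: eq_eseriesr => k _; rewrite /diam_pow image_set0 diam_isometry.
Qed.
End Isometry.

Lemma hausdorff_dim_isometry (R : realType) (T T' : Type) (dist : T -> T -> R)
    (dist' : T' -> T' -> R) (f : T -> T') (g : T' -> T) (A : set T) :
  cancel f g -> cancel g f -> (forall x y, dist' (f x) (f y) = dist x y) ->
  hausdorff_dim dist' (f @` A) = hausdorff_dim dist A.
Proof.
move=> fK gK distf; rewrite /hausdorff_dim.
suff E s d : hausdorff_delta dist' s d (f @` A) = hausdorff_delta dist s d A.
  have Em s : hausdorff_measure dist' s (f @` A) = hausdorff_measure dist s A.
    by congr ereal_sup; apply: eq_imagel => d _; exact: E.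
  by under eq_set => s do rewrite Em.
apply/eqP; rewrite eq_le; apply/andP; split.
  exact: hausdorff_delta_isometry_le.
have -> : hausdorff_delta dist s d A = hausdorff_delta dist s d (g @` (f @` A)).
  by rewrite image_comp (_ : g \o f = id) ?image_id //; apply/funext => x /=.
by apply: hausdorff_delta_isometry_le => x y; rewrite -distf !gK.
Qed.

(** * Boxes in Euclidean space *)

Lemma coord_le_euclidean_dist (R : realType) n (x y : 'rV[R]_n) i :
  `|x 0 i - y 0 i| <= euclidean_dist x y.
Proof.
rewrite /euclidean_dist -sqrtr_sqr ler_wsqrtr // (bigD1 i) //= lerDl.
by apply: sumr_ge0 => j _; exact: sqr_ge0.
Qed.

Lemma euclidean_dist_le (R : realType) n (x y : 'rV[R]_n) (d : R) : 0 <= d ->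
  (forall i, `|x 0 i - y 0 i| <= d) -> euclidean_dist x y <= n%:R * d.
Proof.
move=> d0 xyd; rewrite /euclidean_dist -[leRHS]ger0_norm ?mulr_ge0 // -sqrtr_sqr.
rewrite ler_wsqrtr //; apply: (@le_trans _ _ (\sum_(i < n) d ^+ 2)).
  by apply: ler_sum => i _; rewrite -real_normK ?num_real // lerXn2r ?nnegrE.
rewrite sumr_const card_ord -[leLHS]mulr_natl exprMn ler_wpM2r ?sqr_ge0 //.
by rewrite -natrX ler_nat; case: n {x y xyd} => // n; rewrite expnS leq_pmulr ?expn_gt0.
Qed.

(* [h] pulls a cover of the box back to a cover of the unit cube by boxes whose
   volumes are controlled by the diameters. *)
Lemma hausdorff_measure_box_neq0 (R : realType) n (A : 'I_n -> set R)
    (h : 'I_n -> R -> R) (t d C : R) :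
  (0 < n)%N -> 0 <= t -> 0 < d -> 0 < C ->
  (forall i u, 0 <= u < 1 -> A i (h i u)) ->
  (forall i u v, 0 <= u < 1 -> 0 <= v < 1 -> h i u = h i v -> u = v) ->
  (forall r, 0 < r <= d -> exists w : 'I_n -> R, [/\ forall i, 0 <= w i,
     \prod_i (2 * w i) <= C * r `^ t &
     forall i u v, 0 <= u < 1 -> 0 <= v < 1 -> `|h i u - h i v| <= r ->
       `|u - v| <= w i]) ->
  hausdorff_measure euclidean_dist t (box A) <> 0%E.
Proof.
move=> n0 t0 d0 C0 hA hinj hw.
suff dC : ((C^-1)%:E <= hausdorff_delta euclidean_dist t d (box A))%E.
  have : (hausdorff_delta euclidean_dist t d (box A) <=
          hausdorff_measure euclidean_dist t (box A))%E.
    by apply: ereal_sup_ubound; exists d.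
  move=> /(le_trans dC) + H0; rewrite H0 lee_fin leNgt invr_gt0 C0.
  by [].
apply: le_ereal_inf_tmp => _ [U [AU dU] <-].
pose cube (u : 'I_n -> R) := forall i, 0 <= u i < 1.
pose hrow (u : 'I_n -> R) : 'rV[R]_n := \row_i h i (u i).
have prod0 (w : 'I_n -> R) i : w i = 0 -> \prod_i (2 * w i) = 0.
  by move=> wi; rewrite (bigD1 i) //= wi mulr0 mul0r.
pose i0 := Ordinal n0.
have ex k : exists cw : ('I_n -> R) * ('I_n -> R),
   [/\ forall i, 0 <= cw.2 i,
     forall u, cube u -> U k (hrow u) -> forall i, `|u i - cw.1 i| <= cw.2 i &
     ((\prod_i (2 * cw.2 i))%:E <= C%:E * diam_pow euclidean_dist t (U k))%E].
  have [[u0 [cu0 Uu0]]|noU] := pselect (exists u, cube u /\ U k (hrow u)); last first.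
    (* Here [U k] misses the image of the cube; a degenerate box serves, of volume 0 because n >
       0. *)
    exists (fun=> 0, fun=> 0); split => //= [u cu Uu|].
      by case: noU; exists u.
    rewrite (prod0 (fun=> 0) i0) // mule_ge0 ?diam_pow_ge0 //.
    by rewrite lee_fin ltW.
  have Uk0 : U k == set0 = false.
    by apply/negbTE/eqP => U0; move: Uu0; rewrite U0.
  have [r dr] : exists r, diam euclidean_dist (U k) = r%:E.
    exists (fine (diam euclidean_dist (U k))); rewrite fineK // ge0_fin_numE ?diam_ge0 //.
    by apply: le_lt_trans (dU k) _; rewrite ltry.
  have r0 : 0 <= r by rewrite -lee_fin -dr diam_ge0.
  have rd : r <= d by rewrite -lee_fin -dr.
  have close u i : cube u -> U k (hrow u) -> `|h i (u i) - h i (u0 i)| <= r.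
    move=> cu Uu; rewrite -lee_fin -dr.
    apply: le_trans (dist_le_diam euclidean_dist Uu Uu0).
    rewrite lee_fin; have := coord_le_euclidean_dist (hrow u) (hrow u0) i.
    by rewrite !mxE.
  (* [hw] speaks of positive radii only; at diameter 0 injectivity leaves the single point [u0],
     hence again a degenerate box. *)
  move: r0; rewrite le_eqVlt => /orP[/eqP r0|r0].
    exists (u0, fun=> 0); split => //= [u cu Uu i|].
      have := close u i cu Uu; rewrite -r0 normr_le0 subr_eq0 => /eqP /hinj -> //.
      by rewrite subrr normr0.
    rewrite (prod0 (fun=> 0) i0) // mule_ge0 ?diam_pow_ge0 //.
    by rewrite lee_fin ltW.
  have [|w [w0 wC wP]] := hw r; first by rewrite r0.
  exists (u0, w); split => //= [u cu Uu i|].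
    by apply: wP => //; exact: close.
  by rewrite /diam_pow Uk0 dr poweR_EFin lee_fin.
have [cw cwP] := choice ex.
have : (1 <= \sum_(0 <= k <oo) (\prod_i (2 * (cw k).2 i))%:E)%E.
  apply: (@box_cover _ _ (fun k => (cw k).1)) => [k i|u cu]; first by case: (cwP k).
  have /AU[k _ Uk] : box A (hrow u) by move=> i; rewrite mxE; exact: hA.
  by exists k; case: (cwP k) => _ + _; apply.
move=> /le_trans/(_ (_ : (_ <= \sum_(0 <= k <oo) C%:E * diam_pow euclidean_dist t (U k))%E)) H.
have {H} : (1 <= \sum_(0 <= k <oo) C%:E * diam_pow euclidean_dist t (U k))%E.
  apply: H; apply: lee_nneseries => [k _ _|k _]; last by case: (cwP k).
  by case: (cwP k) => w0 _ _; rewrite lee_fin prodr_ge0 // => i _; rewrite mulr_ge0.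
rewrite nneseriesZl; last by move=> k _; exact: diam_pow_ge0.
by move=> H; rewrite -(@lee_pmul2l _ C%:E) ?lte_fin // -EFinM mulfV ?lt0r_neq0.
Qed.

(** * Cantor subsets of the exact set *)

(** For mixed-radix expansions: dropping a last digit in base N leads from the index of a cell to
    that of its parent. *)
Lemma truncn_mul_div (R : realType) (N : nat) (x : R) : (0 < N)%N -> 0 <= x ->
  (Num.truncn (N%:R * x) %/ N)%N = Num.truncn x.
Proof.
move=> N0 x0; apply/esym/truncn_def.
have /andP[le_c lt_c] := truncn_itv (mulr_ge0 (ler0n R N) x0).
move: (Num.truncn _) le_c lt_c => c le_c lt_c.
have N0' : 0 < N%:R :> R by rewrite ltr0n.
apply/andP; split.
  rewrite -(ler_pM2l N0') (le_trans _ le_c) // -natrM ler_nat mulnC.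
  exact: leq_trunc_div.
rewrite -(ltr_pM2l N0') (lt_le_trans lt_c) // -natrM ler_nat mulnC.
exact: ltn_ceil.
Qed.

Lemma mem_exact_set (R : realType) (psi : R -> R) (x : R) : 0 <= x <= 1 ->
  (forall k : nat, exists (p : int) (q : nat), (k <= q)%N /\
     (1 - k.+2%:R^-1) * psi q%:R < `|x - p%:~R / q%:R| < psi q%:R) ->
  (forall y, 0 < y -> 0 < psi y) ->
  exact_set psi x.
Proof.
move=> x01 H psi0 eps; rewrite /= in_itv /= => /andP[e0 e1]; split => //.
move=> /finite_seqP[s sE].
(* Beyond all denominators of the supposedly finite list [s], and so large that 1/(k + 2) <= eps. *)
pose k := maxn (\max_(z <- s) z.2).+1 (Num.truncn eps^-1).
have [p [q [kq pq]]] := H k.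
have q0 : (0 < q)%N by apply: leq_trans kq; rewrite leq_max.
have : [set pq : int * nat | (0 < pq.2)%N /\
   (1 - eps) * psi pq.2%:R < `|x - pq.1%:~R / pq.2%:R| < psi pq.2%:R] (p, q).
  split => //=; have /andP[le1 ->] := pq; rewrite andbT; apply: le_lt_trans le1.
  rewrite ler_pM2r ?psi0 ?ltr0n // lerD2l lerN2.
  rewrite invf_ple ?posrE ?ltr0n //.
  apply: (le_trans (ltW (truncnS_gt _))); rewrite ler_nat ltnS.
  by rewrite (leq_trans (leq_maxr (\max_(z <- s) z.2).+1 _)).
rewrite sE /= => /(@leq_bigmax_seq _ s xpredT snd) /(_ isT) /=.
rewrite leqNgt (leq_trans _ kq) // (leq_trans _ (leq_maxl _ _)) //.
Qed.

Section ExpandingMap.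
Context {R : realType}.
Variables (psi : R -> R) (b S : nat -> nat) (L : nat -> R).
Hypothesis psi0 : forall x, 0 < x -> 0 < psi x.
Hypothesis psim : forall x y, 0 < x -> x <= y -> psi y <= psi x.
Hypothesis b0 : forall k, (0 < b k)%N.
Hypothesis S0 : forall k, (0 < S k)%N.
Hypothesis kS : forall k, (k <= S k)%N.
Hypothesis psi2 : forall k x, (S k)%:R <= x -> psi x <= x ^- 2 / 64.
Hypothesis L0 : L 0 = 1.
Hypothesis bL : forall k, 2 <= (b k)%:R * L k.
Hypothesis L1 : forall k, 0 < L k.+1 <= k.+2%:R^-1 * psi (4 * b k * S k)%:R / 4.

(** An interval of level k has [N k] children, so that level k consists of [M k] intervals; [sig k]
    bounds from below the gaps between siblings of level k + 1. *)
Let N k := (S k * S k)%N.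
Let M k := (\prod_(j < k) N j)%N.
Let sig k : R := (32 * (b k)%:R * (S k)%:R ^+ 2)^-1.

Let N0 k : (0 < N k)%N. Proof. by rewrite muln_gt0 !S0. Qed.
Let M0 k : (0 < M k)%N. Proof. by rewrite prodn_gt0. Qed.
Let MS k : M k.+1 = (N k * M k)%N. Proof. by rewrite /M big_ord_recr mulnC. Qed.
Let L_gt0 k : 0 < L k. Proof. by case: k => [|k]; [rewrite L0|case/andP: (L1 k)]. Qed.

(** [h u] is the point of the nested intervals whose address is the mixed-radix expansion of u.
    Images closer than every [sig j] with j < k share their first k digits; if the next digits
    differ by d, the images are at least d [sig k] apart while |u - v| <= (d + 1)/[M k.+1], whence
    the second bound. *)
Lemma exact_expanding_map : exists h : R -> R,
  (forall u, 0 <= u < 1 -> exact_set psi (h u)) /\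
  forall k u v, 0 <= u < 1 -> 0 <= v < 1 ->
    (forall j, (j < k)%N -> `|h u - h v| < sig j) ->
    `|u - v| <= (M k)%:R^-1 /\
    `|u - v| <= 64 * (b k)%:R * Num.max `|h u - h v| (sig k) / (M k)%:R.
Proof.
have step k A := @exact_subintervals R psi A (L k) (L k.+1) k.+2%:R^-1 (b k) (S k)
  psi0 psim (@psi2 k) (b0 k) (S0 k) (bL k).
have eps01 k : 0 < (k.+2%:R^-1 : R) < 1.
  by rewrite invr_gt0 ltr0n /= invf_lt1 ?ltr0n // ltr1n.
have [F FP] := choice (fun kA : nat * R => step kA.1 kA.2 (eps01 kA.1) (L1 kA.1)).
(* [A k c] is the left end of the c-th interval of level k: the quotient by [N k'] is the parent,
   the remainder the rank among siblings. *)
pose A := fix A (k c : nat) {struct k} : R :=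
  if k is k'.+1 then F (k', A k' (c %/ N k')%N) (c %% N k')%N else 0.
pose D k (u : R) := Num.truncn ((M k)%:R * u).
pose a k u := A k (D k u).
have DS k u : 0 <= u -> (D k.+1 u %/ N k)%N = D k u.
  by move=> u0; rewrite /D MS natrM -mulrA truncn_mul_div // mulr_ge0.
have aS k u : 0 <= u -> a k.+1 u = F (k, a k u) (D k.+1 u %% N k)%N.
  by move=> u0; rewrite /a /= DS.
have Fa k u : 0 <= u -> [/\ a k u <= a k.+1 u, a k.+1 u + L k.+1 <= a k u + L k &
     exists p : int, exists2 q : nat, (S k <= q)%N &
       forall x, a k.+1 u <= x <= a k.+1 u + L k.+1 ->
         (1 - k.+2%:R^-1) * psi q%:R < `|x - p%:~R / q%:R| < psi q%:R].
  move=> u0; rewrite aS //; have [+ _] := FP (k, a k u).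
  by apply; rewrite ltn_mod.
have nested j k u : 0 <= u -> (j <= k)%N -> a j u <= a k u /\ a k u + L k <= a j u + L j.
  move=> u0; elim: k => [|k IH]; first by rewrite leqn0 => /eqP ->.
  rewrite leq_eqVlt => /orP[/eqP -> //|]; rewrite ltnS => /IH[h1 h2].
  by have [h3 h4 _] := Fa k u u0; split; [exact: le_trans h3|exact: le_trans h2].
have a_le j k u : 0 <= u -> a j u <= a k u + L k.
  move=> u0; have [jk|kj] := leqP j k.
    by have [h1 _] := nested j k u u0 jk; rewrite (le_trans h1) // lerDl ltW.
  have [_ h1] := nested k j u u0 (ltnW kj).
  by apply: le_trans h1; rewrite lerDl ltW.
(* The left ends increase with the level, so their supremum lies in all the nested intervals. *)
pose h u := sup (range (a^~ u)).
have hP k u : 0 <= u -> a k u <= h u <= a k u + L k.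
  move=> u0; apply/andP; split.
    apply: ub_le_sup; last by exists k.
    by exists (a 0%N u + L 0%N) => _ [j _ <-]; exact: a_le.
  apply: ge_sup; first by exists (a 0%N u), 0%N.
  by move=> _ [j _ <-]; exact: a_le.
have sep k u v : 0 <= u -> 0 <= v -> D k u = D k v -> (D k.+1 u < D k.+1 v)%N ->
    (D k.+1 v - D k.+1 u)%:R * sig k <= h v - h u.
  move=> u0 v0 Duv; have := divn_eq (D k.+1 u) (N k); have := divn_eq (D k.+1 v) (N k).
  rewrite !DS // Duv => -> -> lt_mod; rewrite ltn_add2l in lt_mod.
  rewrite subnDl; have [_ /(_ _ _ lt_mod (ltn_pmod _ (N0 k)))] := FP (k, a k u).
  have -> : F (k, a k u) (D k.+1 v %% N k)%N = a k.+1 v by rewrite aS // /a Duv.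
  rewrite -aS //= => /le_trans; apply.
  have /andP[v1 _] := hP k.+1 v v0; have /andP[_ u1] := hP k.+1 u u0; lra.
have sepn k u v : 0 <= u -> 0 <= v -> D k u = D k v -> D k.+1 u <> D k.+1 v ->
    exists2 d : nat, (0 < d)%N & d%:R * sig k <= `|h u - h v| /\
      `|u - v| <= d.+1%:R / (M k.+1)%:R.
  wlog : u v / (D k.+1 u < D k.+1 v)%N => [W u0 v0 Duv Dn|lt_D u0 v0 Duv Dn].
    have [lt_D|lt_D|//] := ltngtP (D k.+1 u) (D k.+1 v); first exact: W.
    by rewrite distrC [`|u - v|]distrC; apply: W => //; exact: nesym.
  exists (D k.+1 v - D k.+1 u)%N; first by rewrite subn_gt0.
  split; first by rewrite distrC (le_trans (sep k u v u0 v0 Duv lt_D)) // ler_norm.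
  have MM : 0 < (M k.+1)%:R :> R by rewrite ltr0n.
  have /andP[u1 u2] := truncn_itv (mulr_ge0 (ler0n R (M k.+1)) u0).
  have /andP[v1 v2] := truncn_itv (mulr_ge0 (ler0n R (M k.+1)) v0).
  rewrite -/(D k.+1 u) in u1 u2; rewrite -/(D k.+1 v) in v1 v2.
  have D1 : (D k.+1 u).+1%:R <= (D k.+1 v)%:R :> R by rewrite ler_nat.
  rewrite ler_pdivlMr // -(gtr0_norm MM) -normrM.
  move: u1 u2 v1 v2 D1; rewrite -!natr1 natrB ?(ltnW lt_D) // => u1 u2 v1 v2 D1.
  rewrite ler_norml; apply/andP; split; lra.
have Deq k u v : 0 <= u < 1 -> 0 <= v < 1 ->
    (forall j, (j < k)%N -> `|h u - h v| < sig j) -> D k u = D k v.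
  move=> /andP[u0 u1] /andP[v0 v1]; elim: k => [_|k IH lt_sig].
    have D0 x : 0 <= x -> x < 1 -> D 0%N x = 0%N.
      by move=> x0 x1; rewrite /D /M big_ord0 mul1r; apply: truncn_def; rewrite x0.
    by rewrite !D0.
  have Duv : D k u = D k v by apply: IH => j jk; apply: lt_sig; exact: ltnW.
  have [//|/eqP Dn] := eqVneq (D k.+1 u) (D k.+1 v).
  have [d d0 [+ _]] := sepn k u v u0 v0 Duv Dn.
  rewrite leNgt => /negP[]; apply: lt_le_trans (lt_sig k (ltnSn k)) _.
  by rewrite ler_peMl ?ler1n // invr_ge0 !mulr_ge0 ?exprn_ge0.
have close k u v : 0 <= u -> 0 <= v -> D k u = D k v -> `|u - v| <= (M k)%:R^-1.
  move=> u0 v0 Duv.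
  have MM : 0 < (M k)%:R :> R by rewrite ltr0n.
  have /andP[+ +] := truncn_itv (mulr_ge0 (ler0n R (M k)) u0).
  have /andP[+ +] := truncn_itv (mulr_ge0 (ler0n R (M k)) v0).
  rewrite -/(D k u) -/(D k v) Duv -natr1 => *.
  rewrite -[leRHS]mul1r ler_pdivlMr // -(gtr0_norm MM) -normrM.
  rewrite ler_norml; apply/andP; split; lra.
exists h; split=> [u /andP[u0 u1]|k u v u01 v01 lt_sig].
  apply: mem_exact_set => //.
    by have := hP 0%N u u0; rewrite L0 add0r.
  move=> k; have [_ _ [p [q Sq pq]]] := Fa k u u0.
  by exists p, q; split; [exact: leq_trans (kS k) Sq|apply: pq; exact: hP].
have Duv := Deq k u v u01 v01 lt_sig.
have /andP[u0 _] := u01; have /andP[v0 _] := v01.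
split; first exact: close.
have [bk Sk] : 0 < (b k)%:R :> R /\ 0 < (S k)%:R :> R by rewrite !ltr0n.
have Mk : 0 < (M k)%:R :> R by rewrite ltr0n.
have M1 : (M k.+1)%:R = (S k)%:R ^+ 2 * (M k)%:R :> R.
  by rewrite MS /N !natrM expr2.
have sig0 : 0 < sig k by rewrite invr_gt0 !mulr_gt0 // exprn_gt0.
have E : (M k.+1)%:R^-1 = 32 * (b k)%:R * sig k / (M k)%:R.
  by rewrite M1 /sig; field; rewrite !lt0r_neq0.
(* For equal digits |u - v| <= 1/[M k.+1], which the term [sig k] of the maximum absorbs. *)
have [D1|/eqP Dn] := eqVneq (D k.+1 u) (D k.+1 v).
  apply: (le_trans (close _ _ _ u0 v0 D1)); rewrite E ler_pM2r ?invr_gt0 //.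
  have sm : sig k <= Num.max `|h u - h v| (sig k) by rewrite le_max lexx orbT.
  have := ler_wpM2l (ltW bk) sm; have := mulr_gt0 bk sig0.
  move: (Num.max _ _) => m *; lra.
have [d d0 [d1 d2]] := sepn k u v u0 v0 Duv Dn.
apply: (le_trans d2); rewrite E.
have : `|h u - h v| <= Num.max `|h u - h v| (sig k) by rewrite le_max lexx.
move: (Num.max _ _) => m /(le_trans d1) dm.
rewrite mulrA ler_pM2r ?invr_gt0 //.
apply: (@le_trans _ _ (64 * (b k)%:R * (d%:R * sig k))); last first.
  by rewrite ler_pM2l // mulr_gt0.
have : d.+1%:R <= 2 * d%:R :> R by rewrite -natrM ler_nat mul2n -addnn -addn1 leq_add2l.
move=> /(ler_wpM2r (ltW (mulr_gt0 bk sig0))).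
move: (_.+1%:R) => w *; lra.
Qed.
End ExpandingMap.

(** * Refining the coordinates in turn *)

(** Interpolation between the bounds 1 and y: min(1, y) <= y^s. *)
Lemma min1_le_powR (R : realType) (x y s : R) : 0 < y -> 0 <= s <= 1 ->
  x <= 1 -> x <= y -> x <= y `^ s.
Proof.
move=> y0 /andP[s0 s1] x1 xy; have [y1|y1] := leP 1 y.
  apply: (le_trans x1); rewrite -(powRr0 y); exact: ler_powR.
by apply: (le_trans xy); rewrite ger1_powR // y0 ltW.
Qed.

(** Stage m below refines coordinate m mod n, so i + k n is the first stage after m that refines
    coordinate i. *)
Lemma first_multiple (i m n : nat) : (i < n)%N -> exists k,
  (m < i + k * n)%N /\ forall j, (j < k)%N -> (i + j * n <= m)%N.
Proof.
move=> lt_in; exists ((m + n - i) %/ n)%N.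
have := divn_eq (m + n - i)%N n; set k := (_ %/ n)%N.
have := ltn_pmod (m + n - i)%N (leq_ltn_trans (leq0n i) lt_in).
move: (_ %% _)%N => x xn E; split; first by lia.
move=> j jk; have : (j.+1 * n <= k * n)%N by rewrite leq_mul2r jk orbT.
by rewrite mulSn; lia.
Qed.

Section Interleaving.
Context {R : realType} {n : nat}.
Variables (psi : 'I_n -> R -> R) (s e : R).
Hypothesis psi0 : forall i x, 0 < x -> 0 < psi i x.
Hypothesis psim : forall i x y, 0 < x -> x <= y -> psi i y <= psi i x.
Hypothesis psi2 : forall i, exists X, forall x, X <= x -> psi i x <= x ^- 2 / 64.
Hypothesis psis : forall i (b : nat) (eps : R) (S0 : nat), (0 < b)%N -> 0 < eps ->
  exists2 S, (S0 <= S)%N & 1 <= (eps * psi i (4 * b * S)%:R / 4) `^ s * S%:R ^+ 2.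
Hypothesis s01 : 0 <= s <= 1.
Hypothesis e01 : 0 < e <= 1.
Hypothesis n0 : (0 < n)%N.

(** For l > 0, [grid l] is an integer b with b l > 2, as the subdivision step requires, and
    [scale l S] is the resulting gap between siblings. Stage m acts on [coord m], whose own level is
    then m %/ n. *)
Let grid (l : R) : nat := (Num.truncn (2 / l)).+1.
Let scale (l : R) (S : nat) : R := (32 * (grid l)%:R * S%:R ^+ 2)^-1.
Let coord (m : nat) : 'I_n := Ordinal (ltn_pmod m n0).

(** A large S is enough: the gap is at most 1/S, so that its power e drops below all current
    lengths, and [psis] grants the last clause at arbitrarily large S. This is where the scales
    become sparse. *)
Let next_scale (m : nat) (l : 'I_n -> R) : (forall i, 0 < l i) -> exists S : nat,
  [/\ (m.+2 <= S)%N, forall x, S%:R <= x -> psi (coord m) x <= x ^- 2 / 64,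
      forall i, scale (l (coord m)) S `^ e <= l i &
      1 <= ((m %/ n).+2%:R^-1 * psi (coord m) (4 * grid (l (coord m)) * S)%:R / 4) `^ s
             * S%:R ^+ 2].
Proof.
move=> l0; have [X XP] := psi2 (coord m); have /andP[e0 e1] := e01.
pose S0 := (m.+2 + Num.truncn X + \sum_i Num.truncn (l i `^ e^-1)^-1).+1%N.
have eps0 : 0 < (m %/ n).+2%:R^-1 :> R by rewrite invr_gt0.
have [S S0S SP] := psis (coord m) S0 (ltn0Sn _ : (0 < grid (l (coord m)))%N) eps0.
have S0' : (0 < S)%N by exact: leq_trans S0S.
exists S; split => // [|x Sx|i].
- by apply: leq_trans S0S; rewrite /S0; lia.
- apply: XP; apply: le_trans Sx; apply: (le_trans (ltW (truncnS_gt _))).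
  by rewrite ler_nat (leq_trans _ S0S) // /S0 ltnS -addnA addnCA leq_addr.
have SR : 0 < S%:R :> R by rewrite ltr0n.
have gR : 1 <= (grid (l (coord m)))%:R :> R by rewrite ler1n.
have lZ : 0 < l i `^ e^-1 by rewrite powR_gt0.
have Sl : (l i `^ e^-1)^-1 <= S%:R.
  apply: (le_trans (ltW (truncnS_gt _))); rewrite ler_nat (leq_trans _ S0S) // /S0.
  by rewrite ltnS (bigD1 i) //= addnCA leq_addr.
have scS : scale (l (coord m)) S <= l i `^ e^-1.
  have gS : 0 < 32 * (grid (l (coord m)))%:R * S%:R ^+ 2 :> R.
    by rewrite !mulr_gt0 ?exprn_gt0 ?ltr0n.
  rewrite -[leRHS]invrK lef_pV2 ?posrE ?invr_gt0 //.
  have S1 : 1 <= S%:R :> R by rewrite ler1n.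
  apply: (le_trans Sl); rewrite expr2; nra.
have sc0 : 0 <= scale (l (coord m)) S by rewrite invr_ge0 !mulr_ge0 ?exprn_ge0.
rewrite [leRHS](_ : _ = (l i `^ e^-1) `^ e); last first.
  by rewrite -powRrM mulVf ?lt0r_neq0 // powRr1 ?ltW.
by apply: ge0_ler_powR; rewrite ?nnegrE ?powR_ge0 ?(ltW e0).
Qed.

(** For a given r let sg (m0 + 1) <= r < sg m0. A coordinate not refined at stage m0 still has
    intervals of length at least r^e, which costs only e in the exponent; the coordinate refined at
    stage m0 is the exceptional one, with exponent s. *)
Lemma interleaved_maps : exists (h : 'I_n -> R -> R) (C d : R),
  [/\ 0 < C, 0 < d <= 1,
   forall i u, 0 <= u < 1 -> exact_set (psi i) (h i u),
   forall i u v, 0 <= u < 1 -> 0 <= v < 1 -> h i u = h i v -> u = v &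
   forall r, 0 < r <= d -> exists j, forall i u v, 0 <= u < 1 -> 0 <= v < 1 ->
     `|h i u - h i v| <= r ->
     `|u - v| <= C * (if i == j then r `^ s else r `^ (1 - e))].
Proof.
have /andP[e0 e1] := e01.
(* Positivity travels with the lengths, so that [next_scale] yields a choice function of the stage
   and the lengths. *)
pose T := {l : 'I_n -> R | forall i, 0 < l i}.
have [G GP] : exists G : nat * T -> nat, forall mt : nat * T,
  [/\ (mt.1.+2 <= G mt)%N,
      forall x, (G mt)%:R <= x -> psi (coord mt.1) x <= x ^- 2 / 64,
      forall i, scale (sval mt.2 (coord mt.1)) (G mt) `^ e <= sval mt.2 i &
      1 <= ((mt.1 %/ n).+2%:R^-1 *
           psi (coord mt.1) (4 * grid (sval mt.2 (coord mt.1)) * G mt)%:R / 4) `^ s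
             * (G mt)%:R ^+ 2].
  have H (mt : nat * T) := next_scale mt.1 (svalP mt.2).
  by have [G GP] := choice H; exists G.
have Gpos mt : (0 < G mt)%N by case: (GP mt) => + _ _ _; apply: leq_trans.
pose newlen (mt : nat * T) : R := (mt.1 %/ n).+2%:R^-1 *
   psi (coord mt.1) (4 * grid (sval mt.2 (coord mt.1)) * G mt)%:R / 4.
have newlen0 mt : 0 < newlen mt.
  by rewrite /newlen !mulr_gt0 ?invr_gt0 // psi0 // ltr0n !muln_gt0 Gpos.
have upd_gt0 (mt : nat * T) i :
    0 < (if i == coord mt.1 then newlen mt else sval mt.2 i).
  by case: ifP => // _; exact: (svalP mt.2).
pose st0 : T := exist (fun l : 'I_n -> R => forall i, 0 < l i) (fun=> 1) (fun=> ltr01).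
(* [st m] holds the interval length of every coordinate before stage m, which changes that of
   [coord m] alone. *)
pose st := fix st (m : nat) : T := if m is m'.+1
  then exist _ (fun i => if i == coord m' then newlen (m', st m') else sval (st m') i)
         (upd_gt0 (m', st m'))
  else st0.
pose l m i := sval (st m) i.
pose S m := G (m, st m).
pose b m := grid (l m (coord m)).
pose sg m := scale (l m (coord m)) (S m).
have l0 i : l 0%N i = 1 by [].
have lS m i : l m.+1 i = if i == coord m then newlen (m, st m) else l m i by [].
have lgt0 m i : 0 < l m i := svalP (st m) i.
have Sm m : (m.+2 <= S m)%N by case: (GP (m, st m)).
have S0 m : (0 < S m)%N by exact: leq_trans (Sm m).
have psiS m x : (S m)%:R <= x -> psi (coord m) x <= x ^- 2 / 64.
  by case: (GP (m, st m)) => _ + _ _; apply.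
have sgl m i : sg m `^ e <= l m i by case: (GP (m, st m)) => _ _ + _; apply.
have lsS m : 1 <= l m.+1 (coord m) `^ s * (S m)%:R ^+ 2.
  by rewrite lS eqxx; case: (GP (m, st m)).
have b0 m : (0 < b m)%N by [].
have bS0 m : 0 < 32 * (b m)%:R * (S m)%:R ^+ 2 :> R.
  by rewrite !mulr_gt0 ?exprn_gt0 ?ltr0n ?S0.
have sg0 m : 0 < sg m by rewrite invr_gt0 !mulr_gt0 ?exprn_gt0 ?ltr0n ?S0.
have bR m : 1 <= (b m)%:R :> R by rewrite ler1n.
have SR m : 1 <= (S m)%:R :> R by rewrite ler1n.
have newl m : newlen (m, st m) <= sg m.
  have xS : (S m)%:R <= (4 * b m * S m)%:R :> R.
    by rewrite ler_nat leq_pmull // muln_gt0.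
  have := psiS m _ xS; set y := psi _ _ => psi_le.
  have y0 : 0 < y by rewrite psi0 // (lt_le_trans _ xS) // ltr0n.
  have eps1 : (m %/ n).+2%:R^-1 <= 1 :> R by rewrite invf_le1 ?ler1n ?ltr0n.
  have -> : newlen (m, st m) = (m %/ n).+2%:R^-1 * y / 4 by [].
  apply: (@le_trans _ _ y).
    have := ler_wpM2r (ltW y0) eps1; move: (_ * y) => z; lra.
  apply: (le_trans psi_le); rewrite /sg /scale -/(b m) -invfM lef_pV2 ?posrE.
  - have bb : (b m)%:R <= (b m)%:R ^+ 2 :> R by rewrite expr2 ler_peMl // ler0n.
    have SS : 0 < (S m)%:R ^+ 2 :> R by rewrite exprn_gt0 // ltr0n.
    rewrite !natrM !exprMn; have := ler_wpM2r (ltW SS) bb.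
    have : 0 <= (b m)%:R ^+ 2 * (S m)%:R ^+ 2 :> R by rewrite mulr_ge0 ?exprn_ge0.
    lra.
  - by rewrite mulr_gt0 // exprn_gt0 // ltr0n !muln_gt0 b0 S0.
  - exact: bS0.
have sgS m : sg m <= m.+1%:R^-1.
  rewrite lef_pV2 ?posrE ?ltr0n //; last exact: bS0.
  have h1 : m.+1%:R <= (S m)%:R :> R by rewrite ler_nat ltnW.
  have h2 : (S m)%:R <= (S m)%:R ^+ 2 :> R by rewrite expr2 ler_peMl // ler0n.
  apply: (le_trans (le_trans h1 h2)); rewrite ler_peMl ?exprn_ge0 //.
  have := bR m; lra.
have sg1 m : sg m <= 1.
  by apply: le_trans (sgS m) _; rewrite invf_le1 ?ler1n ?ltr0n.
(* The chain is sg (m + 1) <= sg (m + 1)^e <= new length of stage m <= sg m. *)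
have sgdec m : sg m.+1 <= sg m.
  apply: le_trans (newl m); have := sgl m.+1 (coord m); rewrite lS eqxx.
  by apply: le_trans; rewrite ger1_powR // sg0 sg1.
have sgmono j m : (j <= m)%N -> sg m <= sg j.
  elim: m => [|m IH]; first by rewrite leqn0 => /eqP ->.
  rewrite leq_eqVlt => /orP[/eqP -> //|]; rewrite ltnS => /IH.
  exact/le_trans/sgdec.
have l1 m i : l m i <= 1.
  elim: m => [|m IH]; rewrite ?l0 // lS; case: ifP => // _.
  exact: le_trans (newl m) (sg1 m).
have gridl m i : 2 <= (grid (l m i))%:R * l m i <= 3.
  have /andP[g1 g2] : 2 / l m i <= (grid (l m i))%:R <= 2 / l m i + 1.
    rewrite ltW ?truncnS_gt //= /grid -natr1 lerD2r.
    by rewrite truncn_le divr_ge0 // ltW.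
  rewrite -ler_pdivrMr ?lgt0 // g1 /=.
  apply: (le_trans (ler_wpM2r (ltW (lgt0 m i)) g2)).
  rewrite mulrDl divfK ?lt0r_neq0 // mul1r.
  have := l1 m i; lra.
have untouched m m' (i : 'I_n) : (m <= m')%N ->
    (forall j, (m <= j < m')%N -> (j %% n)%N <> i :> nat) -> l m' i = l m i.
  elim: m' => [|m' IH]; first by rewrite leqn0 => /eqP ->.
  rewrite leq_eqVlt => /orP[/eqP -> //|]; rewrite ltnS => mm' H.
  rewrite lS ifF ?IH // => [j /andP[mj jm']|].
    by apply: H; rewrite mj ltnW.
  by apply/negbTE/eqP => E; apply: (H m'); rewrite ?mm' ?ltnSn // E.
have coordE (i : 'I_n) k : coord (i + k * n)%N = i.
  by apply/val_inj; rewrite /= addnC modnMDl modn_small.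
have divE (i : 'I_n) k : ((i + k * n) %/ n = k)%N.
  by rewrite addnC divnMDl // divn_small // addn0.
have own (i : 'I_n) j : (j %% n)%N = i :> nat -> j = (i + (j %/ n) * n)%N.
  by move=> <-; rewrite {1}(divn_eq j n) addnC.
have start (i : 'I_n) : l (i + 0 * n)%N i = 1.
  rewrite mul0n addn0 (@untouched 0%N i i) ?l0 // => j /andP[_ ji].
  by rewrite modn_small ?(ltn_trans ji) // => E; rewrite E ltnn in ji.
have next (i : 'I_n) k : l (i + k.+1 * n)%N i = l (i + k * n).+1 i.
  apply: untouched; first by rewrite mulSn; have := n0; lia.
  move=> j /andP[h1 h2] /own E; move: h1 h2; rewrite E !ltn_add2l !ltn_pmul2r //.
  by rewrite ltnS => /leq_trans h /h; rewrite ltnn.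
pose M (i : 'I_n) k := (\prod_(j < k) (S (i + j * n)%N * S (i + j * n)%N))%N.
have [h hP] : exists h : 'I_n -> R -> R, forall i,
    (forall u, 0 <= u < 1 -> exact_set (psi i) (h i u)) /\
    forall k u v, 0 <= u < 1 -> 0 <= v < 1 ->
    (forall j, (j < k)%N -> `|h i u - h i v| < sg (i + j * n)%N) ->
    `|u - v| <= (M i k)%:R^-1 /\
    `|u - v| <= 64 * (b (i + k * n)%N)%:R *
       Num.max `|h i u - h i v| (sg (i + k * n)%N) / (M i k)%:R.
  suff H i : exists h : R -> R, (forall u, 0 <= u < 1 -> exact_set (psi i) (h u)) /\
    forall k u v, 0 <= u < 1 -> 0 <= v < 1 ->
    (forall j, (j < k)%N -> `|h u - h v| < sg (i + j * n)%N) ->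
    `|u - v| <= (M i k)%:R^-1 /\
    `|u - v| <= 64 * (b (i + k * n)%N)%:R *
       Num.max `|h u - h v| (sg (i + k * n)%N) / (M i k)%:R.
    by have [h hP] := choice H; exists h.
  apply: (@exact_expanding_map _ (psi i) (fun k => b (i + k * n)%N)
    (fun k => S (i + k * n)%N) (fun k => l (i + k * n)%N i) (@psi0 i) (@psim i))
    => // k.
  - apply: leq_trans (ltnW (ltnW (Sm _))).
    by apply: leq_trans (leq_addl _ _); rewrite leq_pmulr.
  - by move=> x /psiS; rewrite coordE.
  - by rewrite /b coordE; case/andP: (gridl (i + k * n)%N i).
  - rewrite lgt0 /= next lS coordE eqxx /newlen /= divE coordE.
    by rewrite /b coordE.
have MS i k : (M i k.+1 = S (i + k * n)%N * S (i + k * n)%N * M i k)%N.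
  by rewrite /M big_ord_recr /= mulnC.
have M0 i k : (0 < M i k)%N by rewrite prodn_gt0 // => j; rewrite muln_gt0 S0.
have Mexp i k : (k < M i k)%N.
  elim: k => [|k IH]; first by rewrite /M big_ord0.
  rewrite MS; have := Sm (i + k * n)%N; move: (S _) => S' S2.
  apply: (@leq_trans (2 * M i k)); first by rewrite mul2n -addnn; lia.
  by rewrite leq_mul2r; apply/orP; right; nia.
(* 192 is 64 times the bound 3 of [gridl]; halving sg 0 forces the first m with sg m <= r to have a
   predecessor. *)
exists h, 192, (sg 0%N / 2); split => //.
- by rewrite divr_gt0 //=; have := sg1 0%N; have := sg0 0%N; lra.
- by move=> i u; case: (hP i) => + _; apply.
(* Equal images share all digits, so |u - v| <= 1/[M i k] for every k, and [M i k] > k. *)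
- move=> i u v u01 v01 huv; apply/eqP; rewrite -subr_eq0 -normr_eq0.
  have [//|uv] := eqVneq `|u - v| 0.
  have uv0 : 0 < `|u - v| by rewrite lt_def uv normr_ge0.
  have [_ /(_ (Num.truncn `|u - v|^-1) u v u01 v01)[]] := hP i.
    by move=> j _; rewrite huv subrr normr0.
  rewrite leNgt => /negP[]; rewrite -[ltRHS]invrK ltf_pV2 ?posrE ?invr_gt0 ?ltr0n //.
  by apply: lt_le_trans (truncnS_gt _) _; rewrite ler_nat.
move=> r /andP[r0 rd].
have [m0 [rm0 sgr]] : exists m0, r < sg m0 /\ sg m0.+1 <= r.
  have ex : exists m, sg m <= r.
    exists (Num.truncn r^-1); apply: (le_trans (sgS _)).
    rewrite -[leRHS]invrK lef_pV2 ?posrE ?invr_gt0 ?ltr0n //.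
    exact/ltW/truncnS_gt.
  case: (ex_minnP ex) => -[|m0] sgm min; first by have := sg0 0%N; lra.
  exists m0; split => //; rewrite ltNge; apply/negP => /min; rewrite ltnn //.
exists (coord m0) => i u v u01 v01 huv.
have [k [kgt before]] := first_multiple m0 (ltn_ord i).
have fresh : l (i + k * n)%N i = l m0.+1 i.
  apply: untouched => // j /andP[h1 h2] /own E.
  move: h2; rewrite E ltn_add2l ltn_pmul2r // => /before; rewrite -E.
  by rewrite leqNgt h1.
have [j jk|uv1 uv2] := (hP i).2 k u v u01 v01.
  by apply: (le_lt_trans huv); apply: lt_le_trans rm0 _; apply: sgmono; exact: before.
set y := l m0.+1 i in fresh.
have y0 : 0 < y by exact: lgt0.
have MR : 1 <= (M i k)%:R :> R by rewrite ler1n.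
have MR0 : 0 < (M i k)%:R :> R by rewrite ltr0n.
have uv3 : `|u - v| <= 192 * r / y / (M i k)%:R.
  apply: (le_trans uv2); rewrite ler_pM2r ?invr_gt0 //.
  have mr : Num.max `|h i u - h i v| (sg (i + k * n)%N) <= r.
    by rewrite ge_max huv (le_trans (sgmono _ _ kgt)).
  rewrite ler_pdivlMr // /b coordE fresh.
  have /andP[_] := gridl m0.+1 i; rewrite -/y => gy.
  apply: (@le_trans _ _ (64 * r * ((grid y)%:R * y))); last first.
    have := ler_wpM2l (ltW r0) gy; rewrite mulrCA; nra.
  have gy0 : 0 <= (grid y)%:R * y by rewrite mulr_ge0 ?ler0n ?ltW.
  have := ler_wpM2r gy0 mr; move: (Num.max _ _) ((grid y)%:R : R) => m g; lra.
have r_ge0 := ltW r0.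
case: eqP => [ij|/eqP ij].
  have k0k : (m0 %/ n < k)%N.
    have m0E : m0 = (i + (m0 %/ n) * n)%N by apply: own; rewrite ij.
    by move: kgt; rewrite {1}m0E ltn_add2l ltn_pmul2r.
  have SM : (S m0)%:R ^+ 2 <= (M i k)%:R :> R.
    rewrite expr2 -natrM ler_nat /M (bigD1 (Ordinal k0k)) //=.
    have <- : m0 = (i + (m0 %/ n) * n)%N by apply: own; rewrite ij.
    by rewrite leq_pmulr // prodn_gt0 // => j; rewrite muln_gt0 S0.
  have ySge : 1 <= y `^ s * (S m0)%:R ^+ 2 by rewrite /y ij; exact: lsS.
  (* |u - v| M is at most 1 and at most 192 r/y, hence at most [W]; then S^2 <= M and 1 <= y^s S^2
     give the bound 192 r^s. *)
  pose W := (192 * r / y) `^ s.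
  have zW : `|u - v| * (M i k)%:R <= W.
    apply: min1_le_powR => //; first by rewrite divr_gt0 // mulr_gt0.
      by rewrite -ler_pdivlMr // mul1r.
    by rewrite -ler_pdivlMr.
  have Wy : W * y `^ s <= 192 * r `^ s.
    rewrite -powRM ?divr_ge0 ?mulr_ge0 ?(ltW y0) // divfK ?lt0r_neq0 //.
    rewrite powRM // ler_wpM2r ?powR_ge0 //.
    by rewrite ler1_powR ?(ler1n _ 192) //; case/andP: s01.
  apply: le_trans Wy; have SS : 0 < (S m0)%:R ^+ 2 :> R by rewrite exprn_gt0 ?ltr0n.
  rewrite -(ler_pM2r SS) (le_trans (ler_wpM2l (normr_ge0 _) SM)) // (le_trans zW) //.
  by rewrite -mulrA ler_peMr // powR_ge0.
(* Stage m0 leaves the length of coordinate i alone, and that length is at least sg m0^e. *)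
have yr : r `^ e <= y.
  rewrite /y lS (negbTE ij); apply: le_trans (sgl m0 i).
  by apply: ge0_ler_powR; rewrite ?nnegrE ?ltW.
have re0 : 0 < r `^ e by rewrite powR_gt0.
rewrite powRB ?(gt_eqF r0) ?implybT // powRr1 // (le_trans uv3) //.
apply: (@le_trans _ _ (192 * r / y)).
  by rewrite ler_pdivrMr // ler_peMr // divr_ge0 ?mulr_ge0 // ltW.
rewrite -mulrA ler_pM2l // ler_pM2l // lef_pV2 ?posrE //.
Qed.
End Interleaving.

(** * The lower order *)

Section LowerOrder.
Context {R : realType}.
Variable psi : R -> R.
Hypothesis psi_gt0 : forall x, 0 < x -> 0 < psi x.
Hypothesis psi_noninc : forall x y, 0 < x -> x <= y -> psi y <= psi x.
Hypothesis psi_o : psi =o_ (pinfty_nbhs R) (fun x : R => x ^- 2).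

Lemma little_o_bound (c : R) : 0 < c ->
  exists X, forall x, X <= x -> psi x <= x ^- 2 / c.
Proof.
move=> c0; move/eqoP: psi_o => /(_ c^-1); rewrite invr_gt0 => /(_ c0) [X [_ XP]].
exists (X + 1) => x Xx; have /XP /= : X < x by lra.
rewrite [`|x ^- 2|]ger0_norm ?invr_ge0 ?sqr_ge0 // mulrC.
by apply: le_trans; exact: ler_norm.
Qed.

Lemma order_ratio_lt (t x : R) : 1 < x ->
  (- ln (psi x) / ln x < t) = (x `^ (- t) < psi x).
Proof.
move=> x1; have x0 : 0 < x by lra.
rewrite ltr_pdivrMr ?ln_gt0 // ltrNl -mulNr -ln_powR ltr_ln ?posrE ?powR_gt0 //.
exact: psi_gt0.
Qed.

Lemma lower_order_lt (t X : R) : (lower_order psi < t%:E)%E ->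
  exists2 x, X < x & x `^ (- t) < psi x.
Proof.
move=> lt_t; apply: contrapT => noX.
suff : (t%:E <= lower_order psi)%E by rewrite leNgt lt_t.
(* Cutting at 1 as well keeps ln x positive. *)
rewrite /lower_order limf_einfE; pose V := [set x : R | Num.max X 1 < x].
apply: (@le_trans _ _ (ereal_inf
  ((fun x : R => (- ln (psi x) / ln x)%:E) @` V))).
  apply: le_ereal_inf_tmp => _ [x Vx <-]; rewrite lee_fin leNgt.
  move: Vx; rewrite /V /= gt_max => /andP[Xx x1]; rewrite order_ratio_lt //.
  by apply/negP => xt; apply: noX; exists x.
apply: ereal_sup_ubound; exists V => //.
by exists (Num.max X 1); split; rewrite ?num_real.
Qed.

Lemma lt_lower_order (t : R) : (t%:E < lower_order psi)%E ->
  exists X, forall x, X < x -> psi x <= x `^ (- t).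
Proof.
rewrite /lower_order limf_einfE => /ereal_sup_gt[_ [V [X [_ XV]] <-] tV].
exists (Num.max X 1) => x; rewrite gt_max => /andP[Xx x1].
rewrite leNgt -order_ratio_lt // -leNgt -lee_fin.
apply: (le_trans (ltW tV)); apply: ereal_inf_lbound; exists x => //; exact: XV.
Qed.

(** An order below 2 would give psi x > x^-2 at arbitrarily large x, against the little-o
    hypothesis. *)
Lemma lower_order_ge2 : (2%:E <= lower_order psi)%E.
Proof.
rewrite leNgt; apply/negP => lt2.
have [X XP] := little_o_bound ltr01.
have [x] := lower_order_lt (Num.max X 1) lt2.
rewrite gt_max => /andP[Xx x1]; rewrite ltNge powR_invn ?(le_trans _ (ltW x1)) // => /negP[].
by have := XP x (ltW Xx); rewrite divr1.
Qed.

Lemma order_quotient_le1 : (0 <= 2%:E / lower_order psi <= 1)%E.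
Proof.
have := lower_order_ge2; case: (lower_order psi) => [l| |] //=.
  rewrite lee_fin => l2; rewrite inver gt_eqF; last by lra.
  by rewrite -EFinM !lee_fin divr_ge0 ?ler_pdivrMr /=; lra.
by rewrite invey mule0 lexx lee01.
Qed.

(** For s > 0 some t lies between the order and 2/s, and psi x > x^-t at arbitrarily large x.
    Monotonicity carries this to 4bS just below x, where the quantity is at least a constant times
    S^(2 - st). The case s = 0 is kept apart because 2 over the order may be 0. *)
Lemma frequently_large (s : R) : 0 <= s -> s = 0 \/ (s%:E < 2%:E / lower_order psi)%E ->
  forall (b : nat) (eps : R) (S0 : nat), (0 < b)%N -> 0 < eps ->
  exists2 S, (S0 <= S)%N & 1 <= (eps * psi (4 * b * S)%:R / 4) `^ s * S%:R ^+ 2.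
Proof.
move=> s0 sl b eps S0 b0 eps0.
have [{sl} s_eq|s_neq] := eqVneq s 0.
  exists (maxn S0 1); first exact: leq_maxl.
  by rewrite s_eq powRr0 mul1r exprn_ege1 // ler1n leq_maxr.
have s_gt0 : 0 < s by rewrite lt_def s_neq.
have {sl} [//|sl] := sl; first by move/eqP: s_neq.
have [l lE ls] : exists2 l, lower_order psi = l%:E & s * l < 2.
  move: sl lower_order_ge2; case: (lower_order psi) => [l| |] //=.
    rewrite lee_fin => + l2; rewrite inver gt_eqF; last by lra.
    by rewrite -EFinM lte_fin ltr_pdivlMr; [move=> sl; exists l|lra].
  by rewrite invey mule0 lte_fin ltNge s0.
pose t := (l + 2 / s) / 2.
have lt2s : l < 2 / s by rewrite ltr_pdivlMr // mulrC.
have st : 0 < 2 - s * t.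
  have : s * (2 / s) = 2 by rewrite mulrCA mulfV ?mulr1.
  rewrite /t; lra.
(* [K] collects the factors independent of S, and [Y] below solves K Y^(2 - st) = 1. *)
pose K := (eps / 4) `^ s * (8 * b%:R) `^ (- (t * s)).
have b1 : 1 <= b%:R :> R by rewrite ler1n.
have K0 : 0 < K by rewrite mulr_gt0 ?powR_gt0 //; lra.
pose Y := (K^-1) `^ (2 - s * t)^-1.
have Y0 : 0 <= Y by rewrite powR_ge0.
pose X : R := 4 * b%:R * (S0%:R + Y + 1).
have [x Xx xpsi] : exists2 x, X < x & x `^ (- t) < psi x.
  by apply: lower_order_lt; rewrite lE lte_fin /t; lra.
have b4 : 0 < 4 * b%:R :> R by lra.
have X0 : 0 < X by rewrite mulr_gt0 // ltr_wpDl // addr_ge0.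
have x0 : 0 < x by lra.
pose S := Num.truncn (x / (4 * b%:R)).
have [Sx xS] : (4 * b * S)%:R <= x /\ x < 4 * b%:R * S.+1%:R.
  have /andP[S1 S2] := truncn_itv (divr_ge0 (ltW x0) (ltW b4)).
  split; first by rewrite !natrM mulrC -ler_pdivlMr.
  by rewrite mulrC -ltr_pdivrMr.
have YS : S0%:R + Y < S%:R.
  have := lt_trans Xx xS; rewrite /X ltr_pM2l // -natr1; lra.
have SR0 : 0 < S%:R :> R by rewrite (le_lt_trans _ YS) // addr_ge0.
have S_gt0 : (0 < S)%N by rewrite -(ltr0n R).
have xS2 : x <= 8 * b%:R * S%:R.
  have S1 : 1 <= S%:R :> R by rewrite ler1n.
  have : 0 <= 4 * b%:R * (S%:R - 1) :> R by rewrite mulr_ge0 ?(ltW b4) // subr_ge0.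
  move: xS; rewrite -natr1; lra.
have t0 : 0 <= t.
  by have := lower_order_ge2; rewrite lE lee_fin /t; lra.
exists S; first by rewrite -(ler_nat R); lra.
have psi_ge : (8 * b%:R * S%:R) `^ (- t) <= psi (4 * b * S)%:R.
  apply: (@le_trans _ _ (psi x)); last first.
    by apply: psi_noninc => //; rewrite ltr0n !muln_gt0 b0.
  apply/ltW/(le_lt_trans _ xpsi); rewrite !powRN lef_pV2 ?posrE ?powR_gt0 //.
    by apply: ge0_ler_powR; rewrite ?nnegrE // ltW // (lt_le_trans x0).
  exact: lt_le_trans xS2.
have bS0 : 0 < 8 * b%:R :> R by lra.
apply: (@le_trans _ _ (K * S%:R `^ (2 - s * t))).
  rewrite [leLHS](_ : 1 = K * Y `^ (2 - s * t)); last first.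
    by rewrite /Y -powRrM mulVf ?lt0r_neq0 // powRr1 ?invr_ge0 ?mulfV ?lt0r_neq0 // ltW.
  rewrite ler_pM2l //; apply: ge0_ler_powR; rewrite ?nnegrE //; first exact: ltW.
  by have := ler0n R S0; lra.
have -> : K * S%:R `^ (2 - s * t) =
    (eps * (8 * b%:R * S%:R) `^ (- t) / 4) `^ s * S%:R ^+ 2.
  have e4 : 0 <= eps / 4 by lra.
  rewrite (mulrAC eps) (powRM _ e4) ?powR_ge0 // -powRrM (powRM _ (ltW bS0)) ?ltW //.
  rewrite powRD; last by rewrite gt_eqF // implybT.
  rewrite powR_mulrn ?ltW // mulNr (mulrC s t) /K; ring.
rewrite ler_pM2r ?exprn_gt0 //; apply: ge0_ler_powR => //; rewrite ?nnegrE.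
- by rewrite mulr_ge0 // mulr_ge0 ?powR_ge0 // ltW.
- by rewrite mulr_ge0 // mulr_ge0 ?(ltW eps0) // (le_trans _ psi_ge) ?powR_ge0.
- by rewrite ler_pM2r // ler_pM2l.
Qed.

End LowerOrder.

(** * The upper bound *)

Lemma exact_set_approx (R : realType) (psi : R -> R) (x : R) :
  (forall y z, 0 < y -> y <= z -> psi z <= psi y) -> exact_set psi x ->
  0 <= x <= 1 /\ forall Q : nat, exists (p : int) (q : nat),
    [/\ (Q <= q)%N, (0 < q)%N & `|x - p%:~R / q%:R| < psi q%:R].
Proof.
move=> psim /(_ 2^-1) []; first by rewrite /= in_itv /=; lra.
move=> x01 inf; split => // Q; apply: contrapT => noQ; apply: inf.
(* [B] bounds |p| for all solutions with q < Q, since x is in [0, 1] and psi q <= psi 1; these pairs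
   are thus finitely many. *)
pose B := (Q * (Num.truncn (2 + psi 1)%R).+1)%N.
apply: (@sub_finite_set _ _ ((fun z : nat * nat => (z.1%:Z - B%:Z, z.2)) @`
  (`I_(2 * B).+1 `*` `I_Q))); last first.
  by apply: finite_image; apply: finite_setX; exact: finite_II.
move=> [p q] /= [q0 /andP[_ xq]].
have qQ : (q < Q)%N.
  by rewrite ltnNge; apply/negP => Qq; apply: noQ; exists p, q.
have q0R : 0 < q%:R :> R by rewrite ltr0n.
have pB : `|p%:~R| <= B%:R :> R.
  have pq : `|p%:~R / q%:R| <= (Num.truncn (2 + psi 1)%R).+1%:R :> R.
    apply/ltW/(le_lt_trans _ (truncnS_gt _)).
    have psiq : psi q%:R <= psi 1 by apply: psim => //; rewrite ler1n.
    move: xq x01; rewrite ltr_norml => /andP[x1 x2] /andP[x3 x4].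
    by rewrite ler_norml; apply/andP; split; lra.
  move: pq; rewrite normrM normfV (gtr0_norm q0R) ler_pdivrMr // => /le_trans; apply.
  by rewrite -natrM ler_nat mulnC leq_mul2r ltnW ?orbT.
have {pB} : `|p| <= B%:Z.
  by rewrite -(ler_int R) intr_norm.
move=> pB; have := ler_normlP _ _ pB => -[p1 p2].
exists (absz (p + B%:Z), q); rewrite /=.
  split => //=; move: p1 p2; lia.
by rewrite gez0_abs ?addrK //; lia.
Qed.

Lemma powRXn_comm (R : realType) (x a : R) m : 0 <= x -> (x ^+ m) `^ a = (x `^ a) ^+ m.
Proof. by move=> x0; rewrite -(powR_mulrn m x0) -(powR_mulrn m (powR_ge0 x a)) powRAC. Qed.

Section UpperBound.
Context {R : realType} {n : nat}.
Variables (psi : 'I_n.+1 -> R -> R) (i : 'I_n.+1) (t : R).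
Hypothesis t0 : 0 < t.
Hypothesis psim : forall j y z, 0 < y -> y <= z -> psi j z <= psi j y.
Hypothesis psit : exists Q0 : nat, forall q : nat, (Q0 <= q)%N -> psi i q%:R <= q%:R `^ (- t).

(** For large m, [d m] bounds [psi i q] when q >= 2^m. The factor 3 in [index] makes room for
    numerators from -2^(m+1) up to 2^(m+2), as p/q lies in [-1, 2]. *)
Let d (m : nat) : R := (2 `^ (- t)) ^+ m.
Let cells (m : nat) := (Num.truncn (d m)^-1).+1.
Let index (m : nat) : finType :=
  ('I_(2 ^ m.+1) * 'I_(3 * 2 ^ m.+1) * {ffun 'I_n -> 'I_(cells m)})%type.

(* The box around the points whose [i]-th coordinate is [d m]-close to a
   fraction of denominator [q] with [2 ^ m <= q < 2 ^ m.+1]; numerators are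
   shifted by [2 ^ m.+1] to be natural numbers. *)
Let cell (m : nat) (c : index m) : set 'rV[R]_n.+1 :=
  [set x | `|x 0 i - (c.1.2%:R - (2 ^ m.+1)%:R) / c.1.1%:R| <= d m /\
     forall j : 'I_n, (c.2 j)%:R * d m <= x 0 (lift i j) <= (c.2 j).+1%:R * d m].

Let base01 : 0 < (2 `^ (- t) : R) < 1.
Proof.
rewrite powR_gt0 //= powRN invf_lt1 ?powR_gt0 //.
by rewrite /powR pnatr_eq0 /= expR_gt1 mulr_gt0 // ln_gt0 // ltr1n.
Qed.

Let d0 m : 0 < d m. Proof. by rewrite exprn_gt0; case/andP: base01. Qed.
Let d1 m : d m <= 1.
Proof. by rewrite exprn_ile1 ?ltW //; case/andP: base01. Qed.

Let diam_cell m c : (diam euclidean_dist (@cell m c) <= (2 * n.+1%:R * d m)%:E)%E.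
Proof.
have dm := d0 m.
apply: diam_le => [|x y [xi xj] [yi yj]]; first by rewrite !mulr_ge0 ?ltW.
rewrite mulrAC mulrC; apply: euclidean_dist_le; first by rewrite mulr_ge0 ?ltW.
move=> k; have [j ->|->] := unliftP i k.
  move: (xj j) (yj j); rewrite -natr1 mulrDl mul1r => /andP[x1 x2] /andP[y1 y2].
  by rewrite ler_norml; apply/andP; split; lra.
move: xi yi; move: (_ / _) => z; rewrite !ler_norml => /andP[x1 x2] /andP[y1 y2].
by apply/andP; split; lra.
Qed.

Let cover_cell M x : box (fun j => exact_set (psi j)) x ->
  exists m c, @cell (M + m) c x.
Proof.
move=> xE; have [Q0 psiQ] := psit.
have x01 j : 0 <= x 0 j <= 1 by have [] := exact_set_approx (@psim j) (xE j).
have [_ /(_ (maxn Q0 (2 ^ M)))[p [q [Qq q0 xpq]]]] := exact_set_approx (@psim i) (xE i).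
have q0R : 0 < q%:R :> R by rewrite ltr0n.
pose m' := trunc_log 2 q.
have /andP[qm mq] := trunc_log_bounds (ltnSn 1) q0; rewrite -/m' in qm mq.
have Mm : (M <= m')%N.
  rewrite -ltnS -(ltn_exp2l _ _ (ltnSn 1)); apply: leq_ltn_trans mq.
  exact: leq_trans (leq_maxr _ _) Qq.
exists (m' - M)%N; rewrite subnKC //.
have qd : q%:R `^ (- t) <= d m'.
  have -> : d m' = (2 ^ m')%:R `^ (- t).
    by rewrite natrX powRXn_comm.
  rewrite !powRN lef_pV2 ?posrE ?powR_gt0 ?ltr0n ?expn_gt0 //.
  by apply: ge0_ler_powR; rewrite ?nnegrE ?ler_nat // ltW.
have xd : `|x 0 i - p%:~R / q%:R| <= d m'.
  apply: ltW (lt_le_trans xpq _); apply: le_trans qd; apply: psiQ.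
  exact: leq_trans (leq_maxl _ _) Qq.
have [p1 p2] : - (2 ^ m'.+1)%:Z <= p /\ p < 2 * (2 ^ m'.+1)%:Z.
  have := x01 i; have := d1 m'; move: xd; rewrite ler_norml => /andP[h1 h2] h3 /andP[h4 h5].
  have l1 : -1 <= p%:~R / q%:R :> R by lra.
  have l2 : p%:~R / q%:R <= 2 :> R by lra.
  rewrite ler_pdivlMr // mulN1r in l1; rewrite ler_pdivrMr // in l2.
  have {}l1 : (- q%:Z)%:~R <= p%:~R :> R by rewrite intrN.
  have {}l2 : p%:~R <= (2 * q%:Z)%:~R :> R by rewrite intrM.
  rewrite !ler_int in l1 l2; move: mq; move: (2 ^ m'.+1)%N => N qN.
  by clear -l1 l2 qN; lia.
have pN : (absz (p + (2 ^ m'.+1)%:Z)%R < 3 * 2 ^ m'.+1)%N.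
  move: p1 p2; move: (2 ^ m'.+1)%N => N; lia.
pose c j := Num.truncn (x 0 (lift i j) / d m').
have cN j : (c j < cells m')%N.
  rewrite ltnS le_truncn // -[leRHS]mul1r ler_pM2r ?invr_gt0 //.
  by case/andP: (x01 (lift i j)).
exists (Ordinal mq, Ordinal pN, [ffun j => Ordinal (cN j)]); split => /=.
  have -> : (absz (p + (2 ^ m'.+1)%:Z)%R)%:R - (2 ^ m'.+1)%:R = p%:~R :> R.
    have {2}-> : p = (absz (p + (2 ^ m'.+1)%:Z)%R)%:Z - (2 ^ m'.+1)%:Z.
      by rewrite gez0_abs ?addrK //; lia.
    by rewrite intrB.
  by [].
move=> j; rewrite ffunE /=.
have xj0 : 0 <= x 0 (lift i j) / d m'.
  by rewrite divr_ge0 ?(ltW (d0 m')) //; case/andP: (x01 (lift i j)).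
have /andP[h1 h2] := truncn_itv xj0.
by rewrite -ler_pdivlMr // h1 /= -ler_pdivrMr // ltW.
Qed.

(** Level m has about 4^m (d m)^-n cells of diameter comparable to [d m], so its cost is about 4^m
    (d m)^(s - n), the m-th power of [rho]; the hypothesis says that rho < 1. *)
Lemma hausdorff_measure_box_eq0 (s : R) : 0 <= s -> 2 < t * (s - n%:R) ->
  hausdorff_measure euclidean_dist s (box (fun j => exact_set (psi j))) = 0%E.
Proof.
move=> s0 ts; apply: hausdorff_measure_eq0 => dl e dl0 e0.
pose rho : R := 4 * 2 `^ (- (t * (s - n%:R))).
have rho01 : 0 < rho < 1.
  rewrite mulr_gt0 ?powR_gt0 //= /rho powRN ltr_pdivrMr ?powR_gt0 // mul1r.
  have -> : 4 = 2 `^ 2 :> R by rewrite powR_mulrn // -natrX.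
  by rewrite /powR pnatr_eq0 /= ltr_expR ltr_pM2r // ln_gt0 // ltr1n.
(* 12 4^m counts the pairs (q, p), 2^n comes from [cells m] <= 2/[d m], and the last factor from the
   diameters. *)
pose C : R := 12 * 2 ^+ n * (2 * n.+1%:R) `^ s.
have C0 : 0 < C by rewrite !mulr_gt0 ?powR_gt0 ?exprn_gt0.
have card_le m : #|index m|%:R * (2 * n.+1%:R * d m) `^ s <= C * rho ^+ m.
  have dm := d0 m.
  have cells_le : (cells m)%:R <= 2 / d m :> R.
    have h : (Num.truncn (d m)^-1)%:R <= (d m)^-1 by rewrite truncn_le invr_ge0 ltW.
    have : 1 <= (d m)^-1 by rewrite -invr1 lef_pV2 ?posrE ?ltr01 ?d1.
    rewrite /cells -natr1; lra.
  have dE : (d m) `^ s = d m ^+ n * (2 `^ (- (t * (s - n%:R)))) ^+ m.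
    have -> : d m `^ s = d m `^ n%:R * d m `^ (s - n%:R).
      by rewrite -powRD ?(gt_eqF dm) ?implybT // addrC subrK.
    rewrite powR_mulrn ?ltW //; congr (_ * _).
    by rewrite powRXn_comm ?powR_ge0 // -powRrM mulNr.
  have cardE : #|index m|%:R = 12 * 4 ^+ m * (cells m)%:R ^+ n :> R.
    rewrite !card_prod card_ffun !card_ord !natrM !natrX !exprS (_ : 4 = 2 * 2) ?exprMn; ring.
  rewrite cardE powRM ?mulr_ge0 ?(ltW dm) // dE /C /rho exprMn.
  have : (cells m)%:R ^+ n * d m ^+ n <= 2 ^+ n.
    rewrite -exprMn; apply: lerXn2r; rewrite ?nnegrE //.
      by rewrite mulr_ge0 // ltW.
    by rewrite -ler_pdivlMr.
  set A := _ ^+ n * _ ^+ n; set B := (2 * n.+1%:R) `^ s.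
  set D := (2 `^ _) ^+ m => AB.
  have BD : 0 <= 12 * 4 ^+ m * B * D by rewrite !mulr_ge0 ?powR_ge0 ?exprn_ge0 ?powR_ge0.
  move: (ler_wpM2l BD AB); rewrite /A; clear BD AB dE; move: B D => B D.
  by move: ((cells m)%:R ^+ n) (d m ^+ n) (2 ^+ n) (4 ^+ m) => u v w z; lra.
have /andP[r0 r1] := rho01; have /andP[b0 b1] := base01.
(* Starting at level M makes the geometric tail at most e and all diameters at most [dl]. *)
have [M [M1 M2]] : exists M, rho ^+ M < e * (1 - rho) / C /\ d M < dl / (2 * n.+1%:R).
  have H1 : \forall M \near \oo, `|rho ^+ M| < e * (1 - rho) / C.
    apply: cvgr0_norm_lt; first by apply: cvg_expr; rewrite gtr0_norm.
    by rewrite divr_gt0 // mulr_gt0 // subr_gt0.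
  have H2 : \forall M \near \oo, `|(2 `^ (- t)) ^+ M| < dl / (2 * n.+1%:R).
    apply: cvgr0_norm_lt; first by apply: cvg_expr; rewrite gtr0_norm.
    by rewrite divr_gt0 // mulr_gt0.
  have [M _ MP] : \forall M \near \oo, rho ^+ M < e * (1 - rho) / C /\
      d M < dl / (2 * n.+1%:R).
    near=> M; split; [apply: le_lt_trans (ler_norm _) _; near: M; exact: H1|].
    by apply: le_lt_trans (ler_norm _) _; near: M; exact: H2.
  by exists M; exact: (MP M (leqnn M)).
apply: (@le_trans _ _ (\sum_(0 <= m <oo)
   (#|index (M + m)|%:R * (2 * n.+1%:R * d (M + m)) `^ s)%:E)%E).
  apply: (@hausdorff_delta_cover_fin _ _ _ _ _ _ (fun m => index (M + m))
    (fun m => @cell (M + m))) => [||m c|m c].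
  - exact: ltW.
  - exact: cover_cell.
  - apply: le_trans (diam_cell c) _; rewrite lee_fin.
    have dM : d (M + m) <= d M.
      by rewrite /d exprD ler_piMr ?exprn_ge0 ?exprn_ile1 ?ltW.
    rewrite -ler_pdivlMl ?mulr_gt0 // mulrC; apply: le_trans dM _; exact: ltW.
  - by apply: diam_pow_le => //; rewrite !mulr_ge0 // ltW.
apply: (@le_trans _ _ (\sum_(0 <= m <oo) (C * rho ^+ M * rho ^+ m)%:E)%E).
  apply: lee_nneseries => [m _ _|m _]; first by rewrite lee_fin mulr_ge0 ?powR_ge0.
  by rewrite lee_fin -(mulrA C) -exprD.
apply: lime_le.
  apply: is_cvg_nneseries => m _ _.
  by rewrite lee_fin !mulr_ge0 ?exprn_ge0 ?ltW.
apply: nearW => N; rewrite sumEFin lee_fin.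
apply: (@le_trans _ _ (C * rho ^+ M / (1 - rho))).
  apply: (@geometric_le_lim _ N (C * rho ^+ M) rho) => //.
    by rewrite mulr_ge0 ?exprn_ge0 ?ltW.
  by rewrite gtr0_norm.
rewrite ler_pdivrMr ?subr_gt0 // mulrC -ler_pdivlMr //; exact: ltW.
Unshelve. all: by end_near.
Qed.
End UpperBound.

(** * The dimension of the box *)

(** With v = 2/lambda_i and s = m + v + e, some t below the order satisfies t (v + e) > 2, so the
    covering by cells applies. *)
Lemma hausdorff_dim_box_le (R : realType) m (phi : 'I_m.+1 -> R -> R) i :
  (forall i x, 0 < x -> 0 < phi i x) ->
  (forall i x y, 0 < x -> x <= y -> phi i y <= phi i x) ->
  (forall i, phi i =o_ (pinfty_nbhs R) (fun x : R => x ^- 2)) ->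
  (hausdorff_dim euclidean_dist (box (fun i => exact_set (phi i))) <=
     (m.+1%:R - 1)%:E + 2%:E / lower_order (phi i))%E.
Proof.
move=> phi0 phim phio.
have [v vE] : exists v, (2%:E / lower_order (phi i) = v%:E)%E.
  exists (fine (2%:E / lower_order (phi i))); rewrite fineK //.
  have /andP[h0 h1] := order_quotient_le1 (phi0 i) (phio i).
  by rewrite ge0_fin_numE // (le_lt_trans h1) ?ltry.
have v0 : 0 <= v by have /andP[] := order_quotient_le1 (phi0 i) (phio i); rewrite vE lee_fin.
rewrite vE -EFinD -natr1 addrK; apply/lee_addgt0Pr => e e0.
rewrite -EFinD; apply: ereal_inf_lbound; exists (m%:R + v + e) => //.
have s0 : 0 <= m%:R + v + e by rewrite !addr_ge0 // ltW.
split => //.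
have [t [t0 tl te]] : exists t, [/\ 0 < t, (t%:E < lower_order (phi i))%E & 2 < t * (v + e)].
  have ve0 : 0 < v + e by lra.
  move: vE (lower_order_ge2 (phi0 i) (phio i)); case: (lower_order (phi i)) => [l| |] //=.
    move=> + l2; rewrite lee_fin in l2; rewrite inver gt_eqF -?EFinM; last by lra.
    move=> -[vl]; have lv : l * v = 2 by rewrite -vl mulrCA mulfV ?mulr1 // gt_eqF //; lra.
    have le0 : 0 < l * e by rewrite mulr_gt0 //; lra.
    have q0 : 0 < 2 / (v + e) by rewrite divr_gt0.
    have ql : 2 / (v + e) < l by rewrite ltr_pdivrMr // mulrDr; lra.
    (* The midpoint of 2/(v + e) and the finite order l; for an infinite order any larger t
       works. *)
    exists ((2 / (v + e) + l) / 2); rewrite lte_fin; split; try lra.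
    by rewrite -ltr_pdivrMr //; lra.
  move=> _ _; exists (2 / (v + e) + 1); split; rewrite ?ltry //.
    by rewrite addr_gt0 // divr_gt0.
  by rewrite mulrDl divfK ?gt_eqF //; lra.
have [X XP] := lt_lower_order (phi0 i) tl.
apply: (@hausdorff_measure_box_eq0 _ _ _ i t) => //; last first.
  by rewrite -(addrA m%:R) (addrAC m%:R) subrr add0r.
exists (Num.truncn X).+1 => q Xq; apply: XP.
by apply: lt_le_trans (truncnS_gt _) _; rewrite ler_nat.
Qed.

Section Dimension.
Context {R : realType} {n : nat}.
Variable psi : 'I_n -> R -> R.
Hypothesis psi_gt0 : forall i x, 0 < x -> 0 < psi i x.
Hypothesis psi_noninc : forall i x y, 0 < x -> x <= y -> psi i y <= psi i x.
Hypothesis psi_o : forall i, psi i =o_ (pinfty_nbhs R) (fun x : R => x ^- 2).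
Hypothesis n_gt0 : (0 < n)%N.

(** If s were below the minimum v, the interleaved maps with exponent s' on the exceptional
    coordinate and 1 - e on the others would give boxes of volume O(r^s), because s <= s' + (n -
    1)(1 - e); the measure at s would then be nonzero. *)
Lemma hausdorff_dim_box_ge :
  (\big[mine/+oo%E]_(i < n) ((n%:R - 1)%:E + 2%:E / lower_order (psi i)) <=
   hausdorff_dim euclidean_dist (box (fun i => exact_set (psi i))))%E.
Proof.
pose target i := ((n%:R - 1)%:E + 2%:E / lower_order (psi i))%E.
apply: le_ereal_inf_tmp => _ [s [s0 H0] <-]; rewrite leNgt; apply/negP.
rewrite -/(\big[mine/+oo%E]_(i < n) target i) => s_lt.
have quot i := order_quotient_le1 (psi_gt0 i) (psi_o i).
have tle i : (\big[mine/+oo%E]_(i < n) target i <= target i)%E by exact: bigmin_le.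
have n1 : 1 <= n%:R :> R by rewrite ler1n.
have [v vE] : exists v, \big[mine/+oo%E]_(i < n) target i = v%:E.
  exists (fine (\big[mine/+oo%E]_(i < n) target i)); rewrite fineK // fin_numElt.
  rewrite (lt_trans _ s_lt) ?ltNyr //= (le_lt_trans (tle (Ordinal n_gt0))) //.
  have /andP[_ h] := quot (Ordinal n_gt0).
  by rewrite /target lte_add_pinfty ?ltry // (le_lt_trans h) ?ltry.
rewrite vE in s_lt tle; rewrite lte_fin in s_lt.
have vq i : ((v - (n%:R - 1))%:E <= 2%:E / lower_order (psi i))%E.
  by rewrite EFinB leeBlDl //; exact: tle.
have v1 : v - (n%:R - 1) <= 1.
  rewrite -lee_fin; apply: le_trans (vq (Ordinal n_gt0)) _.
  by case/andP: (quot (Ordinal n_gt0)).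
(* The total loss n e is half of v - s, which leaves s - (n - 1)(1 - e) < v - (n - 1) <=
   2/lambda_i. *)
pose e := (v - s) / (2 * n%:R).
have e0 : 0 < e by rewrite divr_gt0 //; lra.
have ne : n%:R * e = (v - s) / 2 by rewrite /e; field; rewrite gt_eqF //; lra.
have e1 : e <= 1.
  by rewrite ler_pdivrMr; lra.
(* The truncation at 0 is harmless: [frequently_large] admits s = 0 without comparison to the
   order. *)
pose s' := Num.max 0 (s - (n%:R - 1) * (1 - e)).
have s'_ge : s <= s' + (1 - e) * (n%:R - 1).
  have : s - (n%:R - 1) * (1 - e) <= s' by rewrite le_max lexx orbT.
  lra.
have s'_lt : s - (n%:R - 1) * (1 - e) < v - (n%:R - 1) by lra.
have s'01 : 0 <= s' <= 1.
  by rewrite le_max lexx /= ge_max ler01 /=; lra.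
have psi2 i : exists X, forall x, X <= x -> psi i x <= x ^- 2 / 64.
  by apply: little_o_bound.
have psis i : forall (b : nat) (eps : R) (S0 : nat), (0 < b)%N -> 0 < eps ->
    exists2 S, (S0 <= S)%N & 1 <= (eps * psi i (4 * b * S)%:R / 4) `^ s' * S%:R ^+ 2.
  apply: (frequently_large (@psi_gt0 i) (@psi_noninc i) (psi_o i)).
    by case/andP: s'01.
  have [s'0|s'0] := leP (s - (n%:R - 1) * (1 - e)) 0.
    by left; rewrite /s' max_l.
  right; rewrite /s' max_r ?ltW //; apply: lt_le_trans (vq i).
  by rewrite lte_fin.
have [|h [C [d [C0 /andP[d0 d1] hE hinj hw]]]] :=
  interleaved_maps psi_gt0 psi_noninc psi2 psis s'01 _ n_gt0 (e := e).
  by rewrite e0.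
apply: (@hausdorff_measure_box_neq0 _ n (fun i => exact_set (psi i)) h s d ((2 * C) ^+ n)) => //.
  by rewrite exprn_gt0 // mulr_gt0.
move=> r /andP[r0 rd]; have [|j jP] := hw r; first by rewrite r0.
exists (fun i => C * (if i == j then r `^ s' else r `^ (1 - e))); split.
- by move=> i; rewrite mulr_ge0 ?(ltW C0) //; case: ifP => _; exact: powR_ge0.
- under eq_bigr do rewrite mulrA.
  rewrite big_split /= prodr_const card_ord ler_pM2l ?exprn_gt0 ?mulr_gt0 //.
  rewrite (bigD1 j) //= eqxx (eq_bigr (fun=> r `^ (1 - e))); last first.
    by move=> i /negbTE ->.
  rewrite prodr_const cardC1 card_ord -powR_mulrn ?powR_ge0 // -powRrM.
  rewrite -powRD ?(gt_eqF r0) ?implybT //.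
  apply: ger_powR; first by rewrite r0 (le_trans rd).
  by rewrite -subn1 natrB.
- by move=> i u v' u01 v01 huv; exact: jP.
Qed.

Lemma hausdorff_dim_box :
  hausdorff_dim euclidean_dist (box (fun i => exact_set (psi i))) =
  \big[mine/+oo%E]_(i < n) ((n%:R - 1)%:E + 2%:E / lower_order (psi i))%E.
Proof.
apply/eqP; rewrite eq_le hausdorff_dim_box_ge andbT; apply: le_bigmin => [|i _].
  exact: leey.
case: n n_gt0 psi psi_gt0 psi_noninc psi_o i => // m _ phi phi0 phim phio i.
exact: hausdorff_dim_box_le.
Qed.

End Dimension.

(** * The one-dimensional formula and the conclusion *)

Lemma hausdorff_dim_box1 (R : realType) (A : set R) :
  hausdorff_dim euclidean_dist (box (fun _ : 'I_1 => A)) = hausdorff_dim real_dist A.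
Proof.
pose f (x : R) : 'rV[R]_1 := \row_j x.
have fK : cancel f (fun v => v 0 0) by move=> x; rewrite mxE.
have gK : cancel (fun v : 'rV[R]_1 => v 0 0) f.
  by move=> v; apply/rowP => j; rewrite mxE ord1.
rewrite -(@hausdorff_dim_isometry _ _ _ _ euclidean_dist f (fun v => v 0 0) A) //.
  congr hausdorff_dim; apply/seteqP; split => [v Av|_ [x Ax <-] j].
    by exists (v 0 0) => //; exact: Av.
  by rewrite /= mxE.
by move=> x y; rewrite /euclidean_dist big_ord1 !mxE sqrtr_sqr.
Qed.

(** The case n = 1 of the box formula, where the minimum has a single term and n - 1 vanishes. *)
Lemma hausdorff_dim_exact_set (R : realType) (psi : R -> R) :
  (forall x, 0 < x -> 0 < psi x) ->
  (forall x y, 0 < x -> x <= y -> psi y <= psi x) ->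
  psi =o_ (pinfty_nbhs R) (fun x : R => x ^- 2) ->
  hausdorff_dim real_dist (exact_set psi) = (2%:E / lower_order psi)%E.
Proof.
move=> psi0 psim psio; rewrite -hausdorff_dim_box1.
rewrite (@hausdorff_dim_box _ 1 (fun=> psi)) //.
by rewrite big_ord1 /= subrr add0e.
Qed.

Theorem theorem1p4 (R : realType) (n : nat) (psi : 'I_n -> R -> R)
  (hn : (1 <= n)%N)
  (psi_gt0 : forall (i : 'I_n) (x : R), 0 < x -> 0 < psi i x)
  (psi_noninc : forall (i : 'I_n) (x y : R),
     0 < x -> x <= y -> psi i y <= psi i x)
  (psi_o : forall i : 'I_n, psi i =o_ (pinfty_nbhs R) (fun x : R => x ^- 2)) :
  hausdorff_dim euclidean_dist (box (fun i : 'I_n => exact_set (psi i)))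
    = \big[mine/+oo%E]_(i < n)
        ((n%:R - 1)%:E + hausdorff_dim real_dist (exact_set (psi i)))%E
  /\
  \big[mine/+oo%E]_(i < n)
    ((n%:R - 1)%:E + hausdorff_dim real_dist (exact_set (psi i)))%E
    = \big[mine/+oo%E]_(i < n) ((n%:R - 1)%:E + 2%:E / lower_order (psi i))%E.
Proof.
have E : \big[mine/+oo%E]_(i < n)
    ((n%:R - 1)%:E + hausdorff_dim real_dist (exact_set (psi i)))%E
    = \big[mine/+oo%E]_(i < n) ((n%:R - 1)%:E + 2%:E / lower_order (psi i))%E.
  apply: eq_bigr => i _; rewrite hausdorff_dim_exact_set //.
    exact: psi_gt0.
  exact: psi_noninc.
by rewrite E; split => //; exact: hausdorff_dim_box.
Qed.
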